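(* Suppose that $T_W$ is an $L_W$-theory, and $\{L_w \subset L_W : w\in W\}$ is a (directed) sufficient collection of subsignatures of $L_W$. For a partial $L_W$-type $\pi$, let $\pi_w$ denote its reduct to $L_w$. (1) $\pi$ is $L_W$-trivial whenever all reducts $\pi_w$ are $L_w$-trivial. (2) $\pi$ is $L_W$-one-based whenever all reducts $\pi_w$ are $L_w$-one-based. (3) $\pi$ is an $L_W$-modular group whenever all reducts $\pi_w$ are $L_w$-modular groups whenever the group law is $L_w$-definable.
   Context: A collection $\{L_w : w\in W\}$ of subsignatures of $L_W$ is sufficient if every finite subsignature of $L_W$ is contained in some $L_w$; it is directed if, in addition, for all $u,v\in W$ there is $w \in W$ with $L_u\cup L_v\subset L_w$. The word ''directed'' is in parentheses in the claim because restricting to directed collections is regarded as a purely cosmetic choice. For a sufficiently saturated $L$-structure $M$ and a partial $L$-type $\pi$ over $A\subset M$: - $\pi$ is ($L$-)trivial when for any $k\in\mathbb{N}$, if $a_k\in \operatorname{acl}(A,a_1,\dots,a_{k-1})$ and all $a_i$ are realizations of $\pi$, then $a_k\in\operatorname{acl}(A,a_i)$ for some $i<k$. - $\pi$ is ($L$-)one-based if any two sets $B$ and $C$ of realizations of $\pi$ are independent (in the sense of forking or thorn-forking independence) over $\operatorname{acl}^{eq}(A\cup B)\cap\operatorname{acl}^{eq}(A\cup C)$. - $\pi$ is an ($L$-)modular group when the set $G$ of realizations of $\pi$ admits a definable group structure, and any (relatively) definable subset of $G$ is a boolean combination of cosets of (relatively) definable subgroups of $G$. All notions (algebraic closure, independence,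 definability) are in the sense of the signature $L$. *)

(* Defs.v *)
From mathcomp Require Import all_boot.
From mathcomp Require Import mathcomp_extra boolp classical_sets cardinality.

Set Implicit Arguments.
Unset Strict Implicit.
Unset Printing Implicit Defensive.

Local Open Scope classical_set_scope.

(* ['I_n] is declared in a universe too large for the syntax of formulas, so the
   positions of a tuple are indexed by the following copy of it in [Set]. *)
Definition idx (n : nat) : Set := {i : nat | i < n}.

Record arity (S : Type) := Arity {
  alen : nat;
  asort : idx alen -> S
}.
Arguments Arity {S alen}.
Arguments alen {S}.
Arguments asort {S}.

Definition arity1 (S : Type) (s : S) : arity S := Arity (fun _ : idx 1 => s).

Definition amap (S S' : Type) (g : S -> S') (a : arity S) : arity S' :=
  Arity (fun i => g (asort a i)).

Definition tuple_in (S : Type) (U : S -> Type) (a : arity S) : Type :=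
  forall i : idx (alen a), U (asort a i).

(* Signatures are many-sorted because [M^eq] is a many-sorted structure; an
   ordinary signature is the case [srt := unit]. *)
Record signature := Signature {
  srt : Type;
  fsym : Type;
  rsym : Type;
  fdom : fsym -> arity srt;
  fcod : fsym -> srt;
  rdom : rsym -> arity srt
}.

(* Variables are given by a sorted family [V]; there is no fixed supply of
   variable names.  An L(A)-formula in the tuple of variables x is a formula
   whose family of variables is the disjoint sum of x and A (see [pformula]). *)
Inductive tvar (S : Type) (a : arity S) : S -> Type :=
| TVar (i : idx (alen a)) : tvar a (asort a i).

Definition vsum (S : Type) (V V' : S -> Type) : S -> Type :=
  fun s => (V s + V' s)%type.

Definition novar (S : Type) : S -> Type := fun _ => Empty_set.

Inductive term (L : signature) (V : srt L -> Type) : srt L -> Type :=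
| Var s (v : V s) : term V s
| App (f : fsym L) (ts : forall i : idx (alen (fdom f)), term V (asort (fdom f) i)) :
    term V (fcod f).

Inductive formula (L : signature) : (srt L -> Type) -> Type :=
| FBot V : formula V
| FEq V s (t u : term V s) : formula V
| FRel V (r : rsym L) (ts : forall i : idx (alen (rdom r)), term V (asort (rdom r) i)) :
    formula V
| FImp V (p q : formula V) : formula V
| FAll V (s : srt L) (p : formula (vsum V (tvar (arity1 s)))) : formula V.

Record structure (L : signature) := Structure {
  carrier :> srt L -> Type;
  fint : forall f : fsym L, tuple_in carrier (fdom f) -> carrier (fcod f);
  rint : forall r : rsym L, tuple_in carrier (rdom r) -> Prop
}.

Definition env (S : Type) (V U : S -> Type) := forall s, V s -> U s.

Definition tenv (S : Type) (U : S -> Type) (a : arity S) (t : tuple_in U a) :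
    env (tvar a) U :=
  fun s v => match v with TVar i => t i end.

Definition esum (S : Type) (V V' U : S -> Type) (e : env V U) (e' : env V' U) :
    env (vsum V V') U :=
  fun s v => match v with inl x => e s x | inr y => e' s y end.

Definition noenv (S : Type) (U : S -> Type) : env (@novar S) U :=
  fun _ v => match v with end.

Section Semantics.
Variables (L : signature) (M : structure L).

Fixpoint teval (V : srt L -> Type) (e : env V M) s (t : term V s) : M s :=
  match t with
  | Var _ v => e _ v
  | App f ts => fint (fun i => teval e (ts i))
  end.

Fixpoint holds (V : srt L -> Type) (p : formula V) : env V M -> Prop :=
  match p with
  | FBot _ => fun _ => False
  | FEq _ _ t u => fun e => teval e t = teval e u
  | FRel _ r ts => fun e => rint (fun i => teval e (ts i))
  | FImp _ p q => fun e => holds p e -> holds q e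
  | FAll _ s p => fun e =>
      forall m : M s, holds p (esum e (@tenv _ M (arity1 s) (fun=> m)))
  end.

Definition models (T : set (formula (@novar (srt L)))) : Prop :=
  forall p, T p -> holds p (noenv M).

(* sets of elements of M, in all sorts *)
Definition pset := forall s, M s -> Prop.

Definition fullset : pset := fun _ _ => True.
Definition usub (A B : pset) : pset := fun s m => A s m \/ B s m.
Definition isub (A B : pset) : pset := fun s m => A s m /\ B s m.

Definition within (A : pset) (a : arity (srt L)) (t : tuple_in M a) : Prop :=
  forall i, A _ (t i).

Inductive coords (a : arity (srt L)) (X : set (tuple_in M a)) : pset :=
| Coords (t : tuple_in M a) (i : idx (alen a)) : X t -> coords X (t i).

Definition params (A : pset) : srt L -> Type := fun s => {m : M s | A s m}.

Definition penv (A : pset) : env (params A) M := fun s c => sval c.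

Definition pformula (A : pset) (a : arity (srt L)) :=
  formula (vsum (tvar a) (params A)).

Definition sat (A : pset) (a : arity (srt L)) (p : pformula A a)
    (t : tuple_in M a) : Prop :=
  holds p (esum (tenv t) (@penv A)).

Definition realizations (A : pset) (a : arity (srt L)) (pi : set (pformula A a)) :
    set (tuple_in M a) :=
  [set t | forall p, pi p -> sat p t].

Definition partial_type (A : pset) (a : arity (srt L)) (pi : set (pformula A a)) : Prop :=
  forall q, finite_set q -> q `<=` pi -> realizations q !=set0.

Definition same_type (A : pset) (a : arity (srt L)) (t u : tuple_in M a) : Prop :=
  forall p : pformula A a, sat p t <-> sat p u.

Definition acl (A : pset) : pset := fun s m =>
  exists p : pformula A (arity1 s),
    finite_set [set t | sat p t] /\ sat p (fun=> m).

Definition formula2 (a d : arity (srt L)) := formula (vsum (tvar a) (tvar d)).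

(* In [sat2 p t u], and in [divides] and the like below, the formula p = phi(x, y)
   has no parameters, t instantiates x and u instantiates the parameters y. *)
Definition sat2 (a d : arity (srt L)) (p : formula2 a d)
    (t : tuple_in M a) (u : tuple_in M d) : Prop :=
  holds p (esum (tenv t) (tenv u)).

Definition divides (A : pset) (a d : arity (srt L)) (p : formula2 a d)
    (b : tuple_in M d) : Prop :=
  exists (k : nat) (bs : nat -> tuple_in M d),
    (forall n, same_type A b (bs n)) /\
    (forall f : 'I_k -> nat, injective f ->
       ~ exists t : tuple_in M a, forall j, sat2 p t (bs (f j))).

Definition strongly_divides (A : pset) (a d : arity (srt L)) (p : formula2 a d)
    (b : tuple_in M d) : Prop :=
  ~ finite_set [set b' | same_type A b b'] /\
  exists k : nat, forall f : 'I_k -> tuple_in M d, injective f ->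
    (forall j, same_type A b (f j)) ->
    ~ exists t : tuple_in M a, forall j, sat2 p t (f j).

Definition thorn_divides (A : pset) (a d : arity (srt L)) (p : formula2 a d)
    (b : tuple_in M d) : Prop :=
  exists (e : arity (srt L)) (c : tuple_in M e),
    strongly_divides (usub A (coords [set c])) p b.

Inductive notion := Forking | ThornForking.

Definition divides_in (nu : notion) :=
  match nu with Forking => divides | ThornForking => thorn_divides end.

Definition forks (nu : notion) (A : pset) (a d : arity (srt L)) (p : formula2 a d)
    (b : tuple_in M d) : Prop :=
  exists (n : nat) (ds : 'I_n -> arity (srt L)) (ps : forall i, formula2 a (ds i))
         (cs : forall i, tuple_in M (ds i)),
    (forall i, divides_in nu A (ps i) (cs i)) /\
    (forall t : tuple_in M a, sat2 p t b -> exists i, sat2 (ps i) t (cs i)).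

(* B is independent from C over E: for no finite tuple b from B does
   tp(b / C u E) contain a formula that (thorn-)forks over E *)
Definition independent (nu : notion) (B C E : pset) : Prop :=
  forall (a : arity (srt L)) (b : tuple_in M a), within B b ->
  forall (d : arity (srt L)) (p : formula2 a d) (c : tuple_in M d),
    within (usub C E) c -> sat2 p b c -> ~ forks nu E p c.

End Semantics.

(* The cardinal kappa is represented by a type [K].  Cardinals being comparable,
   |X| < |K| says that K does not inject into X. *)
Definition card_lt (X K : Type) : Prop := ~ exists f : K -> X, injective f.

Definition small (K : Type) (L : signature) (M : structure L) (A : pset M) : Prop :=
  card_lt {s : srt L & params A s} K.

Definition saturated (K : Type) (L : signature) (M : structure L) : Prop :=
  forall (A : pset M), small K A ->
  forall (a : arity (srt L)) (p : set (pformula A a)),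
    partial_type p -> realizations p !=set0.

Definition sufficiently_saturated (K : Type) (L : signature) (M : structure L)
    (A : pset M) : Prop :=
  [/\ card_lt nat K,
      card_lt (srt L) K /\ card_lt (fsym L + rsym L) K,
      small K A
    & saturated K M].

Section Imaginaries.
Variables (L : signature) (M : structure L).

Record eqrel := EqRel {
  eqrel_arity : arity (srt L);
  eqrel_form : formula2 eqrel_arity eqrel_arity;
  eqrel_refl : forall t : tuple_in M eqrel_arity, sat2 eqrel_form t t;
  eqrel_sym : forall t u : tuple_in M eqrel_arity, sat2 eqrel_form t u -> sat2 eqrel_form u t;
  eqrel_trans : forall t u v : tuple_in M eqrel_arity,
    sat2 eqrel_form t u -> sat2 eqrel_form u v -> sat2 eqrel_form t v
}.

(* L^eq: the sorts of L, a sort for each parameter-free definable equivalence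
   relation on tuples, and a symbol for each quotient map. *)
Definition eq_fdom (f : fsym L + eqrel) : arity (srt L + eqrel) :=
  match f with
  | inl f => amap inl (fdom f)
  | inr th => amap inl (eqrel_arity th)
  end.

Definition eq_fcod (f : fsym L + eqrel) : srt L + eqrel :=
  match f with
  | inl f => inl (fcod f)
  | inr th => inr th
  end.

Definition eq_signature : signature :=
  @Signature (srt L + eqrel)%type (fsym L + eqrel)%type (rsym L)
    eq_fdom eq_fcod (fun r => amap inl (rdom r)).

(* Here [_ -> Prop] rather than [set _] because of the universe of [set]. *)
Definition eq_class (th : eqrel) (t : tuple_in M (eqrel_arity th)) :
    tuple_in M (eqrel_arity th) -> Prop :=
  fun u => sat2 (eqrel_form th) t u.

Definition eq_carrier (s : srt L + eqrel) : Type :=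
  match s with
  | inl s => M s
  | inr th => {C : tuple_in M (eqrel_arity th) -> Prop | exists t, C = eq_class t}
  end.

Definition eq_fint (f : fsym L + eqrel) :
    tuple_in eq_carrier (eq_fdom f) -> eq_carrier (eq_fcod f) :=
  match f return tuple_in eq_carrier (eq_fdom f) -> eq_carrier (eq_fcod f) with
  | inl f => fun ts => @fint L M f ts
  | inr th => fun ts =>
      exist _ (@eq_class th ts) (ex_intro _ (ts : tuple_in M (eqrel_arity th)) erefl)
  end.

Definition Meq : structure eq_signature :=
  @Structure eq_signature eq_carrier eq_fint (fun r ts => @rint L M r ts).

Definition home (A : pset M) : pset Meq :=
  fun s => match s return eq_carrier s -> Prop with
           | inl s => fun m => A s m
           | inr _ => fun _ => False
           end.

Definition acleq (A : pset M) : pset Meq := acl (home A).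

End Imaginaries.

Section Properties.
Variables (L : signature) (M : structure L) (A : pset M) (a : arity (srt L)).
Variable pi : set (pformula A a).

Definition trivial : Prop :=
  forall (k : nat) (u : 'I_k -> tuple_in M a) (v : tuple_in M a),
    (forall i, realizations pi (u i)) -> realizations pi v ->
    within (acl (usub A (coords (range u)))) v ->
    exists i, within (acl (usub A (coords [set u i]))) v.

(* As usual when working inside a saturated structure, the sets B and C are
   small, that is of cardinality < |K|. *)
Definition one_based (K : Type) (nu : notion) : Prop :=
  forall B C : set (tuple_in M a),
    B `<=` realizations pi -> C `<=` realizations pi ->
    small K (coords B) -> small K (coords C) ->
    independent nu (home (coords B)) (home (coords C))
      (isub (acleq (usub A (coords B))) (acleq (usub A (coords C)))).

(* Definability is with arbitrary parameters from M. *)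
Definition definable3 (R : tuple_in M a -> tuple_in M a -> tuple_in M a -> Prop) : Prop :=
  exists p : formula (vsum (tvar a) (vsum (tvar a) (vsum (tvar a) (params (@fullset L M))))),
    forall x y z, R x y z <->
      holds p (esum (tenv x) (esum (tenv y) (esum (tenv z) (@penv L M _)))).

Definition rel_definable (G D : set (tuple_in M a)) : Prop :=
  D `<=` G /\
  exists p : pformula (@fullset L M) a, forall x, G x -> (D x <-> sat p x).

End Properties.

Section Groups.
Variables (T : Type) (R : T -> T -> T -> Prop).

(* The restriction of R to G is the graph (x, y, z = x * y) of a group law. *)
Definition group_on (G : set T) : Prop :=
  [/\ forall x y, G x -> G y -> exists! z, G z /\ R x y z,
      forall x y z u v p, G x -> G y -> G z -> G u -> G v -> G p ->
        R x y u -> R y z v -> (R u z p <-> R x v p)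
    & exists e, G e /\ forall x, G x ->
        [/\ R e x x, R x e x & exists y, [/\ G y, R x y e & R y x e]]].

Definition subgroup (G H : set T) : Prop := H `<=` G /\ group_on H.

(* left cosets in G; a right coset Hg is the left coset g(g^-1 H g) *)
Definition coset (G H : set T) (g : T) : set T :=
  [set z | G z /\ exists h, H h /\ R g h z].

End Groups.

Inductive boolean_combination (T : Type) (G : set T) (F : set (set T)) : set (set T) :=
| BCbase D : F D -> boolean_combination G F D
| BCcompl D : boolean_combination G F D -> boolean_combination G F (G `\` D)
| BCunion D E : boolean_combination G F D -> boolean_combination G F E ->
    boolean_combination G F (D `|` E).

Section Modular.
Variables (L : signature) (M : structure L) (A : pset M) (a : arity (srt L)).

(* The group law is the restriction of R to the realizations of pi. *)
Definition modular_group (pi : set (pformula A a))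
    (R : tuple_in M a -> tuple_in M a -> tuple_in M a -> Prop) : Prop :=
  let G := realizations pi in
  [/\ definable3 R,
      group_on R G
    & forall D, rel_definable G D ->
        boolean_combination G
          [set X | exists H g, [/\ subgroup R G H, rel_definable G H, G g
                                 & X = coset R G H g]] D].

End Modular.

Section Subsignatures.
Variable L : signature.

Record subsignature := Subsignature {
  sub_fsym : set (fsym L);
  sub_rsym : set (rsym L)
}.

Definition sub_le (S S' : subsignature) : Prop :=
  sub_fsym S `<=` sub_fsym S' /\ sub_rsym S `<=` sub_rsym S'.

Definition sub_finite (S : subsignature) : Prop :=
  finite_set (sub_fsym S) /\ finite_set (sub_rsym S).

Definition sufficient (W : Type) (Lw : W -> subsignature) : Prop :=
  forall S, sub_finite S -> exists w, sub_le S (Lw w).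

Variable S : subsignature.

Definition sig_of : signature :=
  @Signature (srt L) {f | sub_fsym S f} {r | sub_rsym S r}
    (fun f => fdom (sval f)) (fun f => fcod (sval f)) (fun r => rdom (sval r)).

Definition reduct (M : structure L) : structure sig_of :=
  @Structure sig_of (carrier M)
    (fun f => @fint L M (sval f)) (fun r => @rint L M (sval r)).

Fixpoint lift_term (V : srt L -> Type) s (t : @term sig_of V s) : @term L V s :=
  match t in @term _ _ s return @term L V s with
  | Var s v => @Var L V s v
  | App f ts => @App L V (sval f) (fun i => lift_term (ts i))
  end.

Fixpoint lift_formula (V : srt L -> Type) (p : @formula sig_of V) : @formula L V :=
  match p in @formula _ V return @formula L V with
  | FBot V => @FBot L V
  | FEq V s t u => @FEq L V s (lift_term t) (lift_term u)
  | FRel V r ts => @FRel L V (sval r) (fun i => lift_term (ts i))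
  | FImp V p q => @FImp L V (lift_formula p) (lift_formula q)
  | FAll V s p => @FAll L V s (lift_formula p)
  end.

Definition reduct_set (M : structure L) (A : pset M) : pset (reduct M) := A.

Definition reduct_type (M : structure L) (A : pset M) (a : arity (srt L))
    (pi : set (pformula A a)) : set (@pformula sig_of (reduct M) (reduct_set A) a) :=
  [set p | pi (lift_formula p)].

End Subsignatures.

Arguments reduct_type {L} S {M A a} pi.
Arguments definable3 {L} M a R.

(* Main.v *)
(* A failure of triviality, one-basedness or modularity involves finitely many
   formulas, so it is already visible in some L_w.

   For triviality these are the formulas witnessing algebraicity.  For
   modularity, a formula defining D in G defines in some L_w a subset of the
   larger group G_w, and a coset of a subgroup H of G_w meets G in the empty set
   or in a coset of the intersection of H and G; that the group law of the G_w
   restricts to G is an application of saturation.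

   For one-basedness, the formulas are a forking formula p(x, c), the dividing
   formulas covering it, and the formulas putting c into acl^eq.  Dividing over E
   in L implies dividing over the smaller set E_w in L_w, since a sequence of
   realizations of an L-type also realizes its reduct.  Strong division does not
   descend in this way, as k-inconsistency is required of all realizations of a
   type; but by compactness it holds for all realizations of one formula of the
   type.  The compactness argument takes place in M^eq over a base contained in
   acl^eq of a small set, which is small because there are few formulas. *)

Require Import Defs.
From Stdlib Require List.
From Stdlib Require Import Eqdep.
From mathcomp Require Import all_boot.
From mathcomp Require Import mathcomp_extra boolp classical_sets cardinality.

Set Implicit Arguments.
Unset Strict Implicit.
Unset Printing Implicit Defensive.

Local Open Scope classical_set_scope.
Local Notation fsym := Defs.fsym.
Local Notation eqrel := Defs.eqrel.

(** * Cardinal arithmetic *)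

(** Smallness says that K does not inject, so handling sizes takes the comparability of cardinals
    and X x X <= X for infinite X. Both come from Zorn's lemma and serve to bound acl^eq of a small
    set. Two of the L_w may have no common upper bound in the collection. Hence all requirements on
    a subsignature are first gathered into a single finite one, and w is chosen last. Formulas move
    asymmetrically between M^eq and the M^eq of a reduct. Upwards every formula passes. Downwards
    its equivalence relations, symbols and parameters must exist in the reduct, which is the case
    once the subsignature is large enough; an element of acl^eq in the sense of L is algebraic in
    the reduct only from some point on. Saturation is given for M alone, so compactness in M^eq goes
    through real tuples that represent imaginaries. *)

Definition embeds (X Y : Type) : Prop := exists f : X -> Y, injective f.

Lemma embeds_trans (X Y Z : Type) : embeds X Y -> embeds Y Z -> embeds X Z.
Proof. by case=> f fi [g gi]; exists (g \o f); exact: inj_comp. Qed.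

Lemma embeds_of_rel (X Y : Type) (R : X -> Y -> Prop) :
  (forall x, exists y, R x y) -> (forall x x' y, R x y -> R x' y -> x = x') ->
  embeds X Y.
Proof.
move=> tot inj; have [f fP] := choice tot.
by exists f => x x' e; apply: (inj _ _ (f x')) => //; rewrite -e.
Qed.

Lemma embeds_total (X Y : Type) : embeds X Y \/ embeds Y X.
Proof.
pose P : set (set (X * Y)) := [set G | forall p q, G p -> G q -> (p.1 = q.1 <-> p.2 = q.2)].
have [] := @Zorn_bigcup _ P.
  move=> F FP tot p q [G FG Gp] [G' FG' Gq].
  case: (tot _ _ FG FG') => GG'.
    by apply: (FP _ FG') => //; exact: GG'.
  by apply: (FP _ FG) => //; exact: GG'.
move=> G [PG maxG].
case: (pselect (forall x, exists y, G (x, y))) => [totX|/existsNP[x0 /forallNP nx0]].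
  left; apply: (embeds_of_rel totX) => x x' y Gx Gx'.
  exact: (PG _ _ Gx Gx').2.
case: (pselect (forall y, exists x, G (x, y))) => [totY|/existsNP[y0 /forallNP ny0]].
  right; apply: (embeds_of_rel totY) => y y' x Gx Gx'.
  exact: (PG _ _ Gx Gx').1.
have GG' : G `<` (G `|` [set (x0, y0)]).
  split; first by move=> p; left.
  by move=> /(_ (x0, y0) (or_intror erefl)); exact: nx0.
exfalso; apply: (maxG _ GG').
move=> [x y] [x' y'] [Gp|[-> ->]] [Gq|[-> ->]] //=.
- exact: (PG _ _ Gp Gq).
- by split=> e; [case: (nx0 y)|case: (ny0 x)]; rewrite -e.
- by split=> e; [case: (nx0 y')|case: (ny0 x')]; rewrite e.
Qed.

Section Square.
Variable X : Type.

(** G is the graph of an injection from Y x Y to Y. It determines Y through the pairs (y, y), so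
    Zorn's lemma can be applied to graphs alone. *)
Record pairing_graph (G : set ((X * X) * X)) (Y : set X) : Prop := PairingGraph {
  pg_dom : forall x y z, G ((x, y), z) -> [/\ Y x, Y y & Y z];
  pg_tot : forall x y, Y x -> Y y -> exists z, G ((x, y), z);
  pg_fun : forall p z z', G (p, z) -> G (p, z') -> z = z';
  pg_inj : forall p p' z, G (p, z) -> G (p', z) -> p = p'
}.

Lemma pg_sub G Y G' Y' : pairing_graph G Y -> pairing_graph G' Y' ->
  G `<=` G' -> Y `<=` Y'.
Proof.
by move=> gG gG' GG' y Yy; have [z /GG'/(pg_dom gG')[]] := pg_tot gG Yy Yy.
Qed.

Lemma pg_bigcup (F : set (set ((X * X) * X))) : F !=set0 ->
  (forall G, F G -> exists Y, pairing_graph G Y) -> total_on F subset ->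
  exists Y, pairing_graph (\bigcup_(G in F) G) Y.
Proof.
move=> [G0 FG0] Fg tot.
have common G1 G2 : F G1 -> F G2 -> exists G Y,
    [/\ F G, pairing_graph G Y, G1 `<=` G & G2 `<=` G].
  move=> F1 F2; have [Y1 g1] := Fg _ F1; have [Y2 g2] := Fg _ F2.
  by case: (tot _ _ F1 F2) => s; [exists G2, Y2|exists G1, Y1]; split.
exists [set x | exists G Y, [/\ F G, pairing_graph G Y & Y x]]; split.
- move=> x y z [G FG Gz]; have [Y gG] := Fg _ FG.
  by have [Yx Yy Yz] := pg_dom gG Gz; split; exists G, Y.
- move=> x y [G1 [Y1 [F1 g1 Y1x]]] [G2 [Y2 [F2 g2 Y2y]]].
  have [G [Y [FG gG s1 s2]]] := common _ _ F1 F2.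
  have [z Gz] := pg_tot gG (pg_sub g1 gG s1 Y1x) (pg_sub g2 gG s2 Y2y).
  by exists z, G.
- move=> p z z' [G1 F1 g1] [G2 F2 g2].
  have [G [Y [FG gG s1 s2]]] := common _ _ F1 F2.
  exact: (pg_fun gG (s1 _ g1) (s2 _ g2)).
- move=> p p' z [G1 F1 g1] [G2 F2 g2].
  have [G [Y [FG gG s1 s2]]] := common _ _ F1 F2.
  exact: (pg_inj gG (s1 _ g1) (s2 _ g2)).
Qed.

(* Pairs not in Y x Y are sent into h(Y), their kind being recorded by one of
   three labels c i in Y. *)
Lemma pg_extend G Y (h : X -> X) (c : 'I_3 -> X) : pairing_graph G Y ->
  injective c -> (forall i, Y (c i)) ->
  (forall y, Y y -> ~ Y (h y)) -> (forall y z, Y y -> Y z -> h y = h z -> y = z) ->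
  exists G' Y', pairing_graph G' Y' /\ G `<` G'.
Proof.
move=> gG ci cY hY hi.
pose m i b := if b : bool then h i else i.
pose tag (b b' : bool) : 'I_3 :=
  if b then (if b' then inord 0 else inord 1) else inord 2.
have tagP b b' d d' : b || b' -> d || d' -> tag b b' = tag d d' -> b = d /\ b' = d'.
  by case: b b' d d' => [] [] [] [] //= _ _ /(congr1 val); rewrite /= !inordK.
have mi x y b d : Y x -> Y y -> m x b = m y d -> x = y /\ b = d.
  case: b d => [] [] Yx Yy //= e.
  - by split=> //; exact: hi.
  - by case: (hY _ Yx); rewrite e.
  - by case: (hY _ Yy); rewrite -e.
(* The underlying pair (x, y) is coded by u, the label and u together by v, and h moves the result
   out of Y. *)
pose N : set ((X * X) * X) := [set t | exists x y b b' u v,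
  [/\ Y x, Y y, b || b', G ((x, y), u) & G ((c (tag b b'), u), v)] /\
  t = ((m x b, m y b'), h v)].
have NY p z : N (p, z) -> ~ Y z.
  move=> [x [y [b [b' [u [v [[_ _ _ _ Gv] [_ ->]]]]]]]].
  by apply: hY; have [] := pg_dom gG Gv.
have NG p z : N (p, z) -> ~ (Y p.1 /\ Y p.2).
  move=> [x [y [b [b' [u [v [[Yx Yy bb _ Gv] [-> _]]]]]]]] /= [].
  by case: b b' bb Gv => [] [] //= _ _ H1 H2; [case: (hY x)|case: (hY x)|case: (hY y)].
have GY p z : G (p, z) -> [/\ Y p.1, Y p.2 & Y z].
  by case: p => x y /(pg_dom gG).
exists (G `|` N), (Y `|` h @` Y); split; last first.
  split; first by move=> t; left.
  (* The inclusion is strict: the new graph has a value at the pair whose components are both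
     [h (c ord0)], a point outside Y. *)
  have [u Gu] := pg_tot gG (cY ord0) (cY ord0).
  have [_ _ Yu] := pg_dom gG Gu.
  have [v Gv] := pg_tot gG (cY (tag true true)) Yu.
  move=> /(_ ((h (c ord0), h (c ord0)), h v)) sub.
  have /GY[/= Yh _ _] : G ((h (c ord0), h (c ord0)), h v).
    by apply: sub; right; exists (c ord0), (c ord0), true, true, u, v.
  by case: (hY (c ord0)).
split.
- move=> x y z [/(pg_dom gG)[Yx Yy Yz]|]; first by split; left.
  move=> [x' [y' [b [b' [u [v [[Yx Yy bb Gu Gv] [-> -> ->]]]]]]]].
  have [_ _ Yv] := pg_dom gG Gv.
  split; last by right; exists v.
  + by case: {bb Gv} b => /=; [right; exists x'|left].
  + by case: {bb Gv} b' => /=; [right; exists y'|left].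
- move=> x y Yx Yy.
  have mP t : (Y `|` h @` Y) t -> exists s b, Y s /\ t = m s b.
    by case=> [Yt|[s Ys <-]]; [exists t, false|exists s, true].
  have [s [b [Ys ->]]] := mP _ Yx; have [t [b' [Yt ->]]] := mP _ Yy.
  have [u Gu] := pg_tot gG Ys Yt; have [_ _ Yu] := pg_dom gG Gu.
  case bb: (b || b').
    have [v Gv] := pg_tot gG (cY (tag b b')) Yu.
    by exists (h v); right; exists s, t, b, b', u, v; split; split.
  by case: b b' bb => [] [] // _; exists u; left.
- move=> p z z' [Gz|Nz] [Gz'|Nz'].
  + exact: (pg_fun gG Gz Gz').
  + by have [? ? _] := GY _ _ Gz; case: (NG _ _ Nz').
  + by have [? ? _] := GY _ _ Gz'; case: (NG _ _ Nz).
  + case: Nz => x [y [b [b' [u [v [[Yx Yy bb Gu Gv] [ep ->]]]]]]].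
    case: Nz' => r [s [d [d' [w [t [[Yr Ys dd Gw Gt] [e ->]]]]]]].
    move: e; rewrite ep => -[e1 e2].
    have [? ?] := mi _ _ _ _ Yx Yr e1; have [? ?] := mi _ _ _ _ Yy Ys e2; subst.
    by move: Gt; rewrite -(pg_fun gG Gu Gw) => /(pg_fun gG Gv) ->.
- move=> p p' z [Gz|Nz] [Gz'|Nz'].
  + exact: (pg_inj gG Gz Gz').
  + by have [_ _ ?] := GY _ _ Gz; case: (NY _ _ Nz').
  + by have [_ _ ?] := GY _ _ Gz'; case: (NY _ _ Nz).
  + case: Nz => x [y [b [b' [u [v [[Yx Yy bb Gu Gv] [-> ez]]]]]]].
    case: Nz' => r [s [d [d' [w [t [[Yr Ys dd Gw Gt] [-> e]]]]]]].
    rewrite {}ez in e.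
    have [_ _ Yv] := pg_dom gG Gv; have [_ _ Yt] := pg_dom gG Gt.
    have vt := hi _ _ Yv Yt e; subst t.
    have [/ci e1 e2] := pg_inj gG Gv Gt; subst w.
    have [-> ->] := tagP _ _ _ _ bb dd e1.
    by have [-> ->] := pg_inj gG Gu Gw.
Qed.

Lemma embeds_square : embeds nat X -> embeds (X * X) X.
Proof.
move=> [n ni].
pose G0 : set ((X * X) * X) :=
  [set t | exists i j, t = ((n i, n j), n (pickle (i, j)))].
have g0 : pairing_graph G0 (range n).
  split.
  - by move=> x y z [i [j [-> -> ->]]]; split; eexists.
  - by move=> _ _ [i _ <-] [j _ <-]; exists (n (pickle (i, j))), i, j.
  - by move=> p z z' [i [j [-> ->]]] [i' [j' [/ni -> /ni -> ->]]].
  - move=> p p' z [i [j [-> ->]]] [i' [j' [-> /ni]]].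
    by move=> /(pcan_inj pickleK) [-> ->].
(* The union with G0 makes the empty chain harmless. *)
pose P : set (set ((X * X) * X)) := [set G | exists Y, pairing_graph (G `|` G0) Y].
have [F FP tot|G [[Y gG] maxG]] := @Zorn_bigcup _ P.
  have [F0|/set0P nF] := eqVneq F set0.
    by rewrite F0 bigcup_set0; exists (range n); rewrite set0U.
  have [|_ [H FH <-]|_ _ [H FH <-] [H' FH' <-]|Y gY] :=
      @pg_bigcup [set H `|` G0 | H in F].
  - by have [H FH] := nF; exists (H `|` G0), H.
  - exact: FP.
  - by case: (tot _ _ FH FH') => s; [left|right]; exact: setSU.
  exists Y; congr (pairing_graph _ Y): gY; apply/seteqP; split.
    by move=> t [_ [H FH <-]] [Ht|]; [left; exists H|right].
  by move=> t [[H FH Ht]|Gt]; [|have [H FH] := nF]; (exists (H `|` G0); first by exists H);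
    [left|right].
have nY i : Y (n i).
  have [z _ Gz] : exists2 z, True & G0 ((n i, n i), z) by eexists => //; exists i, i.
  by have [] := pg_dom gG (or_intror Gz).
pose c (i : 'I_3) := n i.
have ci : injective c by move=> i j /ni /val_inj.
(* If Y injects into its complement, [pg_extend] contradicts maximality. Otherwise X is the union of
   Y and a set no larger than Y, and embeds in Y. *)
have [[h hi]|[k ki]] := embeds_total {y | Y y} {x | ~ Y x}.
  pose h' y := if pselect (Y y) is left Yy then sval (h (exist _ y Yy)) else y.
  have [| | |G' [Y' [g' [s ns]]]] := @pg_extend _ Y h' c gG ci.
  - by move=> i; exact: nY.
  - by move=> y Yy; rewrite /h'; case: pselect => // Yy'; exact: (svalP (h _)).
  - move=> y z Yy Yz; rewrite /h'; case: pselect => // {}Yy; case: pselect => // {}Yz.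
    by move=> /eq_sig_hprop e; have [] := hi _ _ (e (fun _ => @Prop_irrelevance _)).
  exfalso; apply: (maxG G').
    split; first by move=> t Gt; apply: s; left.
    by move=> G'G; apply: ns => t /G'G; left.
  exists Y'; rewrite setUidl // => t G0t; apply: s; right.
exact: G0t.
have /choice[f fP] : forall p : X * X, exists z, Y p.1 -> Y p.2 -> (G `|` G0) (p, z).
  move=> [x y]; case: (pselect (Y x /\ Y y)) => [[Yx Yy]|nxy].
    by have [z Gz] := pg_tot gG Yx Yy; exists z.
  by exists x => /= Yx Yy; case: nxy.
have fY x y : Y x -> Y y -> Y (f (x, y)).
  by move=> Yx Yy; have [] := pg_dom gG (fP (x, y) Yx Yy).
have fi p q : Y p.1 -> Y p.2 -> Y q.1 -> Y q.2 -> f p = f q -> p = q.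
  move=> p1 p2 q1 q2 e; apply: (pg_inj gG (fP p p1 p2)); rewrite e; exact: fP.
(* X embeds in Y as a disjoint union of two pieces, told apart by the first components [n 0] and
   [n 1]. *)
pose m x := match pselect (Y x) with
  | left _ => f (n 0, x) | right nYx => f (n 1, sval (k (exist _ x nYx))) end.
have mY x : Y (m x).
  rewrite /m; case: pselect => Yx; apply: fY; try exact: nY; first exact: Yx.
  exact: (svalP (k _)).
have mi : injective m.
  have kY x nx : Y (sval (k (exist (fun x => ~ Y x) x nx))) by exact: (svalP (k _)).
  have kn0 x : Y (n x) by exact: nY.
  move=> x y; rewrite /m; case: pselect => Yx; case: pselect => Yy /fi /= e.
  - by have [] := e (kn0 _) Yx (kn0 _) Yy.
  - by have [/ni] := e (kn0 _) Yx (kn0 _) (kY _ _).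
  - by have [/ni] := e (kn0 _) (kY _ _) (kn0 _) Yy.
  - have [/eq_sig_hprop e'] := e (kn0 _) (kY _ _) (kn0 _) (kY _ _).
    by have [] := ki _ _ (e' (fun _ => @Prop_irrelevance _)).
exists (fun p => f (m p.1, m p.2)) => -[x y] [x' y'] /fi /=.
by move=> /(_ (mY _) (mY _) (mY _) (mY _)) [/mi -> /mi ->].
Qed.

End Square.

Lemma card_lt_embeds (X Y K : Type) : embeds X Y -> card_lt Y K -> card_lt X K.
Proof. by move=> XY YK KX; apply: YK; exact: embeds_trans KX XY. Qed.

(** Entries are coded by nested pairs. The length is recorded too, because the end marker [n 0] may
    itself be the code of a pair. *)
Lemma embeds_seq (X : Type) : embeds nat X -> embeds (seq X) X.
Proof.
move=> nX; have [g gi] := embeds_square nX; have [n ni] := nX.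
pose f s := foldr (fun x y => g (x, y)) (n 0) s.
exists (fun s => g (n (size s), f s)) => s t /gi [/ni].
elim: s t => [|x s IH] [|y t] //= [est] /gi [-> e].
by rewrite (IH t).
Qed.

Section SmallTypes.
Variables (K : Type) (hK : card_lt nat K).

(** An infinite common bound below K, to which [embeds_square] applies. *)
Lemma card_lt_common (X Y : Type) : card_lt X K -> card_lt Y K ->
  exists Z : Type, [/\ card_lt Z K, embeds nat Z, embeds X Z & embeds Y Z].
Proof.
have refl (Z : Type) : embeds Z Z by exists id.
move=> hX hY; have [XY|YX] := embeds_total X Y.
  have [nY|Yn] := embeds_total nat Y; first by exists Y.
  by exists nat; split => //; exact: embeds_trans XY Yn.
have [nX|Xn] := embeds_total nat X; first by exists X.
by exists nat; split => //; exact: embeds_trans YX Xn.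
Qed.

Lemma card_lt_prod (X Y : Type) : card_lt X K -> card_lt Y K -> card_lt (X * Y) K.
Proof.
move=> hX hY; have [Z [hZ nZ [f fi] [g gi]]] := card_lt_common hX hY.
apply: card_lt_embeds hZ; apply: embeds_trans (embeds_square nZ).
by exists (fun p => (f p.1, g p.2)) => -[x y] [x' y'] [/fi -> /gi ->].
Qed.

Lemma card_lt_sum (X Y : Type) : card_lt X K -> card_lt Y K -> card_lt (X + Y) K.
Proof.
move=> hX hY; have [Z [hZ nZ [f fi] [g gi]]] := card_lt_common hX hY.
apply: card_lt_embeds (card_lt_prod hK hZ).
exists (fun p => match p with inl x => (0, f x) | inr y => (1, g y) end).
by move=> [x|y] [x'|y'] [] // => [/fi|/gi] ->.
Qed.

Lemma card_lt_seq (X : Type) : card_lt X K -> card_lt (seq X) K.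
Proof.
move=> hX; have [Z [hZ nZ [f fi] _]] := card_lt_common hX hX.
apply: card_lt_embeds hZ; apply: embeds_trans (embeds_seq nZ).
by exists (map f); exact: inj_map.
Qed.

Lemma card_lt_tree (X : Type) : card_lt X K -> card_lt (GenTree.tree X) K.
Proof.
move=> hX; apply: card_lt_embeds (card_lt_seq (card_lt_sum hK hX)).
by exists (@GenTree.encode X); exact: pcan_inj (@GenTree.codeK X).
Qed.

End SmallTypes.

Lemma sval_inj (T : Type) (P : T -> Prop) : injective (@proj1_sig T P).
Proof. by move=> [x px] [y py] /= e; subst y; congr exist; exact: Prop_irrelevance. Qed.

(** * Counting formulas *)

Definition idxs (n : nat) : seq (idx n) := pmap insub (iota 0 n).

Lemma mem_idxs n (i : {i : nat | i < n}) : i \in (idxs n : seq {i : nat | i < n}).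
Proof. by rewrite mem_pmap_sub mem_iota /= add0n (valP i). Qed.

Lemma eq_map_idxs n (T : Type) (F G : idx n -> T) :
  map F (idxs n) = map G (idxs n) -> forall i, F i = G i.
Proof.
move=> e i; have := mem_idxs i; move: e; rewrite /idxs.
elim: (pmap _ _) => // j s IH [ej es]; rewrite in_cons => /orP[/eqP ->//|].
exact: IH.
Qed.

Definition vidx (S : Type) (a : arity S) s (x : tvar a s) : idx (alen a) :=
  match x with TVar i => i end.

Lemma existT_tvar (S : Type) (a : arity S) s (x : tvar a s) :
  existT (tvar a) s x = existT (tvar a) _ (TVar (vidx x)).
Proof. by case: x. Qed.

Lemma vidx_inj (S : Type) (a : arity S) s : injective (@vidx S a s).
Proof.
move=> x y e; apply: inj_pair2.
by rewrite (existT_tvar x) (existT_tvar y) e.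
Qed.

Lemma idx1_eq (i j : idx 1) : i = j.
Proof. by apply: (@val_inj _ _ {i : nat | i < 1}); case: i j => [[|i] ?] [[|j] ?]. Qed.

Section Encoding.
Variables (L : signature) (X : Type).
Variables (cs : srt L -> X) (cf : fsym L -> X) (cr : rsym L -> X).
Notation tree := (GenTree.tree X).

(** Dependently typed syntax is coded by untyped trees. Injectivity of the code is used twice: to
    count formulas, and to show that [lift_formula] is injective. *)
Fixpoint enc_term (V : srt L -> Type) (vc : forall s, V s -> tree) s (t : term V s) : tree :=
  match t with
  | Var s v => GenTree.Node 0 [:: vc s v]
  | App f ts => GenTree.Node 1
      (GenTree.Leaf (cf f) :: [seq enc_term vc (ts i) | i <- idxs (alen (fdom f))])
  end.

(* The code of a bound variable is Node 0 [::]; Node 1 shifts the other codes. *)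
Definition vc_bind (V : srt L -> Type) (vc : forall s, V s -> tree) (s0 : srt L) :
    forall s, vsum V (tvar (arity1 s0)) s -> tree :=
  fun s v => match v with
             | inl v => GenTree.Node 1 [:: vc s v]
             | inr _ => GenTree.Node 0 [::]
             end.

Fixpoint enc (V : srt L -> Type) (p : formula V) : (forall s, V s -> tree) -> tree :=
  match p with
  | FBot _ => fun=> GenTree.Node 0 [::]
  | FEq _ s t u => fun vc =>
      GenTree.Node 1 [:: GenTree.Leaf (cs s); enc_term vc t; enc_term vc u]
  | FRel _ r ts => fun vc => GenTree.Node 2
      (GenTree.Leaf (cr r) :: [seq enc_term vc (ts i) | i <- idxs (alen (rdom r))])
  | FImp _ p q => fun vc => GenTree.Node 3 [:: enc p vc; enc q vc]
  | FAll _ s p => fun vc => GenTree.Node 4 [:: GenTree.Leaf (cs s); enc p (@vc_bind _ vc s)]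
  end.

Hypotheses (csi : injective cs) (cfi : injective cf) (cri : injective cr).

Lemma enc_term_inj (V : srt L -> Type) (vc : forall s, V s -> tree) s :
  (forall s, injective (vc s)) -> injective (@enc_term V vc s).
Proof.
move=> vci.
(* The code of a variable does not record its sort, so equality of the sorts is assumed; for an
   application the symbol determines it. *)
suff gen : forall s (t : term V s) s' (u : term V s'), s = s' ->
    enc_term vc t = enc_term vc u -> existT (term V) s t = existT (term V) s' u.
  by move=> t u e; apply: inj_pair2; exact: gen.
move=> {}s t; elim: t => {s} [s v|f ts IH] s' [{}s' v'|f' ts'] //=.
  by move=> ess; subst s' => -[/vci ->].
move=> _ [/cfi ef]; subst f' => /eq_map_idxs e.
congr existT; congr App; apply: functional_extensionality_dep => i.
exact/inj_pair2/IH.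
Qed.

Lemma vc_bind_inj (V : srt L -> Type) (vc : forall s, V s -> tree) s0 :
  (forall s, injective (vc s)) -> forall s, injective (@vc_bind V vc s0 s).
Proof.
move=> vci s [v|v] [v'|v'] //=; first by case=> /vci ->.
by move=> _; congr inr; apply: vidx_inj; exact: idx1_eq.
Qed.

Lemma enc_inj (V : srt L -> Type) (vc : forall s, V s -> tree) :
  (forall s, injective (vc s)) -> injective (fun p : formula V => enc p vc).
Proof.
move=> vci p q; move: q vc vci.
elim: p => {V} [V|V s t u|V r ts|V p IHp q IHq|V s p IH].
- by move=> q; case: q.
- move=> q; case: q t u => // {}V s' t' u' t u vc vci /= [/csi es]; subst s'.
  by move=> /(enc_term_inj vci) -> /(enc_term_inj vci) ->.
- move=> q; case: q ts => // {}V r' ts' ts vc vci /= [/cri er]; subst r'.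
  move=> /eq_map_idxs e; congr FRel; apply: functional_extensionality_dep => i.
  exact: enc_term_inj (e i).
- move=> r; case: r p IHp q IHq => // {}V p' q' p IHp q IHq vc vci /= [].
  by move=> /(IHp _ _ vci) -> /(IHq _ _ vci) ->.
- move=> r; case: r s p IH => // {}V s' p' s p IH vc vci /= [/csi es]; subst s'.
  by move=> /(IH _ _ (vc_bind_inj vci)) ->.
Qed.

End Encoding.

Lemma finite_set_list (T : Type) (F : set T) :
  finite_set F -> exists s : seq T, forall x, F x <-> List.In x s.
Proof.
move=> /(@finite_seqP {classic T})[s ->]; exists s => x /=.
elim: s => [|y s IH] /=; first by [].
rewrite in_cons; split=> [/orP[/eqP ->|/IH]|[->|/IH xs]]; [by left|by right| |].
  by rewrite eqxx.
by rewrite xs orbT.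
Qed.

Lemma In_mem (T : eqType) (s : seq T) x : x \in s -> List.In x s.
Proof.
by elim: s => //= y s IH; rewrite in_cons => /orP[/eqP ->|/IH]; [left|right].
Qed.

Lemma In_idxs n (i : idx n) : List.In i (idxs n).
Proof. exact: (@In_mem _ (idxs n : seq {i : nat | i < n}) i (mem_idxs i)). Qed.

Lemma arity1_inj (S : Type) : injective (@arity1 S).
Proof.
move=> s s' e; unfold arity1 in e; injection e => e'.
exact: (congr1 (fun f : idx 1 -> S => f (exist _ 0 isT)) (inj_pair2 _ _ _ _ _ e')).
Qed.

Lemma card_lt_arity (S K : Type) : card_lt nat K -> card_lt S K -> card_lt (arity S) K.
Proof.
move=> hK hS; apply: card_lt_embeds (card_lt_prod hK hK (card_lt_seq hK hS)).
exists (fun a => (alen a, [seq asort a i | i <- idxs (alen a)])).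
move=> [n f] [m g] [/= e]; subst m => /eq_map_idxs e.
by congr Arity; apply: functional_extensionality_dep.
Qed.

Lemma eqrel_eq (L : signature) (M : structure L) (th th' : eqrel M) :
  existT (fun a => formula2 a a) _ (eqrel_form th) =
    existT (fun a => formula2 a a) _ (eqrel_form th') -> th = th'.
Proof.
case: th th' => [a p r s t] [a' p' r' s' t'] /= e.
have ea : a = a' := congr1 (@projT1 _ _) e.
by subst a'; have {}e := inj_pair2 _ _ _ _ _ e; subst p'; congr EqRel; exact: Prop_irrelevance.
Qed.

Lemma params_inj (L : signature) (M : structure L) (P : pset M)
    (c c' : {s : srt L & params P s}) :
  existT M _ (sval (projT2 c)) = existT M _ (sval (projT2 c')) -> c = c'.
Proof.
case: c c' => [s m] [s' m'] /= e; have es : s = s' := congr1 (@projT1 _ _) e.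
by subst s'; congr existT; apply: sval_inj; exact: inj_pair2 e.
Qed.

Section SmallLanguage.
Variables (K : Type) (hK : card_lt nat K) (L : signature).
Hypotheses (hsrt : card_lt (srt L) K) (hsym : card_lt (fsym L + rsym L) K).

(** The code of a formula does not determine its family of variables, so the index j is kept beside
    it. *)
Lemma card_lt_formulas (J Y : Type) (V : J -> srt L -> Type)
    (vc : forall j s, V j s -> Y) :
  (forall j s, injective (@vc j s)) -> card_lt J K -> card_lt Y K ->
  card_lt {j & formula (V j)} K.
Proof.
move=> vci hJ hY.
have hX := card_lt_tree hK (card_lt_sum hK (card_lt_sum hK hsrt hsym) hY).
apply: card_lt_embeds (card_lt_prod hK hJ hX).
exists (fun p => (projT1 p, enc (fun s => inl (inl s)) (fun f => inl (inr (inl f)))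
  (fun r => inl (inr (inr r))) (projT2 p) (fun s v => GenTree.Leaf (inr (@vc _ s v))))).
move=> [j p] [j' q] [/= e]; subst j'; move/enc_inj => -> //.
- by move=> ? ? [].
- by move=> ? ? [].
- by move=> ? ? [].
- by move=> s v v' [/vci].
Qed.

Lemma card_lt_pformula (M : structure L) (A : pset M) : small K A ->
  card_lt {a & pformula A a} K.
Proof.
move=> hA.
apply: (@card_lt_formulas _ (nat + {s : srt L & params A s}) (fun a => vsum (tvar a) (params A))
  (fun a s v => match v with inl x => inl (sval (vidx x)) | inr c => inr (existT _ s c) end)).
- move=> a s [x|c] [y|d] //=; last by move=> [e]; rewrite (inj_pair2 _ _ _ _ _ e).
  move=> [e]; congr inl; apply: vidx_inj.
  exact: sval_inj e.
- exact: card_lt_arity.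
- exact: card_lt_sum.
Qed.

Lemma card_lt_eqrel (M : structure L) : card_lt (eqrel M) K.
Proof.
have : card_lt {a : arity (srt L) & formula2 a a} K.
  apply: (@card_lt_formulas _ (nat + nat) (fun a => vsum (tvar a) (tvar a))
    (fun a s v => match v with inl x => inl (sval (vidx x)) | inr x => inr (sval (vidx x)) end)).
  - by move=> a s [x|x] [y|y] //= [e]; rewrite (@vidx_inj _ _ _ x y) //; exact: sval_inj e.
  - exact: card_lt_arity.
  - exact: card_lt_sum.
apply: card_lt_embeds; exists (fun th => existT (fun a => formula2 a a) _ (eqrel_form th)).
by move=> th th'; exact: eqrel_eq.
Qed.

Lemma card_lt_eq_srt (M : structure L) : card_lt (srt (eq_signature M)) K.
Proof. exact (card_lt_sum hK hsrt (card_lt_eqrel (M:=M))). Qed.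

Lemma card_lt_eq_sym (M : structure L) :
  card_lt (fsym (eq_signature M) + rsym (eq_signature M)) K.
Proof.
apply: card_lt_embeds (card_lt_sum hK hsym (card_lt_eqrel (M:=M))).
exists (fun f => match f with
  | inl (inl f) => inl (inl f) | inl (inr th) => inr th | inr r => inl (inr r) end).
by move=> [[f|th]|r] [[f'|th']|r'] //= [->].
Qed.

(** An algebraic element is determined by an algebraic formula over A and its position in a list of
    the finitely many solutions. *)
Lemma small_acl (M : structure L) (A : pset M) : small K A -> small K (acl A).
Proof.
move=> hA; apply: card_lt_embeds (card_lt_prod hK (card_lt_pformula hA) hK).
have hs s (p : pformula A (arity1 s)) : exists l : seq (M s),
    finite_set [set t | sat p t] -> forall m : M s, sat p (fun=> m) -> List.In m l.
  case: (pselect (finite_set [set t | sat p t])) => [fp|]; last by exists [::].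
  have /finite_set_list[l lP] : finite_set [set m : M s | sat p (fun=> m)].
    have := finite_image (fun t : tuple_in M (arity1 s) => t (exist _ 0 isT : idx 1)) fp.
    by apply: sub_finite_set => m pm; exists ((fun=> m) : tuple_in M (arity1 s)).
  by exists l => _ m pm; exact/lP.
have [l lP] : exists l : forall s (p : pformula A (arity1 s)), seq (M s),
    forall s (p : pformula A (arity1 s)),
    finite_set [set t | sat p t] -> forall m : M s, sat p (fun=> m) -> List.In m (l s p).
  have hs' s := choice (hs s).
  by exists (fun s => projT1 (hs' s)) => s; exact: projT2 (hs' s).
apply: (@embeds_of_rel _ _ (fun x y => exists s (p : pformula A (arity1 s)),
  y.1 = existT _ _ p /\ exists m : M s, existT M s m = existT M _ (sval (projT2 x)) /\
    List.nth_error (l s p) y.2 = Some m)).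
- move=> [s [m [p [fp pm]]]].
  have [n nP] := List.In_nth_error _ _ (lP s p fp m pm).
  by exists (existT _ _ p, n), s, p; split => //; exists m.
- move=> x x' [y n] [r [p [/= ey [c [e1 e2]]]]].
  move=> [r' [p' [/= e [c' [e1' e2']]]]]; subst y.
  have er : r = r' := arity1_inj (congr1 (@projT1 _ _) e).
  subst r'; have {}e := inj_pair2 _ _ _ _ _ e; subst p'.
  move: e2'; rewrite e2 => -[e2']; subst c'.
  by apply: params_inj; rewrite -e1 -e1'.
Qed.

End SmallLanguage.

(** * Groups and cosets *)

Section GroupLaw.
Variables (T : Type) (R : T -> T -> T -> Prop) (G : set T).
Hypothesis hG : group_on R G.

Lemma group_mul x y : G x -> G y -> exists2 z, G z & R x y z.
Proof. by case: hG => H _ _ Gx Gy; have [z [[Gz Rz] _]] := H _ _ Gx Gy; exists z. Qed.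

Lemma group_fun x y z z' : G x -> G y -> G z -> G z' -> R x y z -> R x y z' -> z = z'.
Proof.
case: hG => H _ _ Gx Gy Gz Gz' Rz Rz'; have [u [_ uP]] := H _ _ Gx Gy.
by rewrite -(uP z) // -(uP z').
Qed.

Lemma group_assoc x y z u v p : G x -> G y -> G z -> G u -> G v -> G p ->
  R x y u -> R y z v -> (R u z p <-> R x v p).
Proof. by case: hG => _ H _; exact: H. Qed.

Definition unit_of e := G e /\ forall x, G x ->
  [/\ R e x x, R x e x & exists y, [/\ G y, R x y e & R y x e]].

(** For the unit u and an inverse f of e, f e = f (e e) = (f e) e = u e = e, while f e = u. *)
Lemma idempotent_unit e : G e -> R e e e -> unit_of e.
Proof.
move=> Ge Ree; have [_ _ [u uU]] := hG.
have [Gu uP] := uU; have [Rue Reu [f [Gf Ref Rfe]]] := uP _ Ge.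
have Rfee : R f e e by apply/(group_assoc Gf Ge Ge Gu Ge Ge Rfe Ree).
by rewrite (group_fun Gf Ge Ge Gu Rfee Rfe).
Qed.

Lemma unit_unique e e' : unit_of e -> unit_of e' -> e = e'.
Proof.
move=> [Ge eP] [Ge' eP']; have [R1 _ _] := eP _ Ge'; have [_ R2 _] := eP' _ Ge.
exact: group_fun R2 R1.
Qed.

Lemma group_div x z : G x -> G z -> exists2 y, G y & R x y z.
Proof.
move=> Gx Gz; have [_ _ [e [Ge eP]]] := hG.
have [_ _ [i [Gi Rxi Rix]]] := eP _ Gx; have [Rez _ _] := eP _ Gz.
have [y Gy Riz] := group_mul Gi Gz.
by exists y => //; apply/(group_assoc Gx Gi Gz Ge Gy Gz Rxi Riz).
Qed.

Lemma group_cancel x y y' z : G x -> G y -> G y' -> G z ->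
  R x y z -> R x y' z -> y = y'.
Proof.
move=> Gx Gy Gy' Gz R1 R2; have [_ _ [e [Ge eP]]] := hG.
have [_ _ [i [Gi Rxi Rix]]] := eP _ Gx.
have [Rey _ _] := eP _ Gy; have [Rey' _ _] := eP _ Gy'.
apply: (group_fun Gi Gz) => //.
  by apply/(group_assoc Gi Gx Gy Ge Gz Gy Rix R1).
by apply/(group_assoc Gi Gx Gy' Ge Gz Gy' Rix R2).
Qed.

End GroupLaw.

Section Subgroups.
Variables (T : Type) (R : T -> T -> T -> Prop) (G G' : set T).
Hypotheses (hG : group_on R G) (hG' : group_on R G') (sG : G' `<=` G).

Lemma unit_subgroup e : unit_of R G' e -> unit_of R G e.
Proof.
move=> [Ge eP]; apply: idempotent_unit => //; first exact: sG.
by have [] := eP _ Ge.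
Qed.

(** Products and inverses formed in H and in G' solve the same equations in G, hence agree; the two
    units agree because each is an idempotent of G. *)
Lemma subgroup_setI H : subgroup R G H -> subgroup R G' (H `&` G').
Proof.
move=> [sH gH]; split; first exact: subIsetr.
split.
- move=> x y [Hx Gx] [Hy Gy].
  have [z Hz Rz] := group_mul gH Hx Hy; have [z' Gz' Rz'] := group_mul hG' Gx Gy.
  have ezz : z = z'.
    exact: (group_fun hG (sH _ Hx) (sH _ Hy) (sH _ Hz) (sG Gz') Rz Rz').
  exists z; split; first by split=> //; split=> //; rewrite ezz.
  move=> t [[Ht _] Rt].
  exact: (group_fun gH Hx Hy Hz Ht Rz Rt).
- move=> x y z u v p [Hx _] [Hy _] [Hz _] [Hu _] [Hv _] [Hp _].
  exact: (group_assoc gH).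
- have [_ _ [e eU]] := gH; have [_ _ [e' eU']] := hG'.
  have eUG : unit_of R G e.
    apply: (idempotent_unit hG); first exact: sH eU.1.
    by have [] := eU.2 _ eU.1.
  have eUG' := unit_subgroup eU'.
  have ee := unit_unique hG eUG eUG'; subst e'.
  exists e; split; first by split; [exact: eU.1|exact: eU'.1].
  move=> x [Hx Gx].
  have [R1 R2 [y [Hy R3 R4]]] := eU.2 _ Hx.
  have [_ _ [y' [Gy' R3' _]]] := eU'.2 _ Gx.
  split=> //; exists y; split => //; split=> //.
  rewrite (_ : y = y') //.
  exact: (group_cancel hG (sG Gx) (sH _ Hy) (sG Gy') eUG.1 R3 R3').
Qed.

(** Write g' = g h'. For z = g h in G', the element h'^-1 h of H and the element g'^-1 z of G' both
    solve g' k = z in G, so they coincide and lie in the intersection. *)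
Lemma coset_setI H g g' : subgroup R G H -> G g ->
  coset R G H g g' -> G' g' ->
  coset R G H g `&` G' = coset R G' (H `&` G') g'.
Proof.
move=> [sH gH] Gg [Gg1 [h' [Hh' Rg']]] Gg'; apply/seteqP; split=> z.
  move=> [[Gz [h [Hh Rz]]] Gz']; split=> //.
  have [k Hk Rk] := group_div gH Hh' Hh.
  have [l Gl Rl] := group_div hG' Gg' Gz'.
  have Rkz : R g' k z.
    by apply/(group_assoc hG Gg (sH _ Hh') (sH _ Hk) Gg1 (sH _ Hh) Gz Rg' Rk).
  exists k; split=> //; split=> //.
  by rewrite (group_cancel hG Gg1 (sH _ Hk) (sG Gl) Gz Rkz Rl).
move=> [Gz [k [[Hk _] Rkz]]]; split=> //; split; first exact: sG.
have [h Hh Rh] := group_mul gH Hh' Hk.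
exists h; split=> //.
by apply/(group_assoc hG Gg (sH _ Hh') (sH _ Hk) Gg1 (sH _ Hh) (sG Gz) Rg' Rh).
Qed.

Lemma boolean_combination_setI (F F' : set (set T)) D :
  (forall D, F D -> boolean_combination G' F' (D `&` G')) ->
  boolean_combination G F D -> boolean_combination G' F' (D `&` G').
Proof.
move=> FF'; elim=> {D} [D /FF'//|D _ IH|D E _ IHD _ IHE].
  have -> : (G `\` D) `&` G' = G' `\` (D `&` G').
    apply/seteqP; split=> x; first by move=> [[Gx nD] G'x]; split=> // -[].
    by move=> [G'x nD]; split=> //; split; [exact: sG|move=> Dx; apply: nD].
  exact: BCcompl.
by rewrite setIUl; exact: BCunion.
Qed.

End Subgroups.

(** * Definability *)

Section Definability.
Variables (L : signature) (M : structure L).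

(** A property of sets of environments, so that substitutions and derived connectives become closure
    properties and the formulas need not be written out. *)
Definition dfn (V : srt L -> Type) (X : env V M -> Prop) : Prop :=
  exists p : formula V, forall e, X e <-> holds p e.

Lemma dfn_holds (V : srt L -> Type) (p : formula V) : dfn (fun e => holds p e).
Proof. by exists p. Qed.

Section Closure.
Variable V : srt L -> Type.
Implicit Types X Y : env V M -> Prop.

Lemma dfn_bot : dfn (fun _ : env V M => False).
Proof. by exists (FBot V). Qed.

Lemma dfn_eq s (t u : term V s) : dfn (fun e : env V M => teval e t = teval e u).
Proof. by exists (FEq t u). Qed.

Lemma dfn_imp X Y : dfn X -> dfn Y -> dfn (fun e => X e -> Y e).
Proof.
move=> [p pP] [q qP]; exists (FImp p q) => e /=.
by split=> XY /pP /XY /qP.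
Qed.

Lemma dfn_iff X Y : (forall e, X e <-> Y e) -> dfn X -> dfn Y.
Proof. by move=> XY [p pP]; exists p => e; rewrite -XY. Qed.

Lemma dfn_not X : dfn X -> dfn (fun e => ~ X e).
Proof. by move=> dX; exact: dfn_imp dX dfn_bot. Qed.

Lemma dfn_true : dfn (fun _ : env V M => True).
Proof. by apply: dfn_iff (dfn_not dfn_bot) => e; split=> // _ []. Qed.

Lemma dfn_and X Y : dfn X -> dfn Y -> dfn (fun e => X e /\ Y e).
Proof.
move=> dX dY; apply: dfn_iff (dfn_not (dfn_imp dX (dfn_not dY))) => e.
split=> [n|[Xe Ye] n]; last exact: n.
by split; apply: contrapT => m; apply: n => // /m.
Qed.

Lemma dfn_all s (X : env (vsum V (tvar (arity1 s))) M -> Prop) : dfn X ->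
  dfn (fun e => forall m : M s, X (esum e (@tenv _ M (arity1 s) (fun=> m)))).
Proof.
by move=> [p pP]; exists (FAll p) => e /=; split=> H m; apply/pP; exact: H.
Qed.

Lemma dfn_forall_list (I : Type) (l : seq I) (X : I -> env V M -> Prop) :
  (forall i, dfn (X i)) -> dfn (fun e => forall i, List.In i l -> X i e).
Proof.
move=> dX; elim: l => [|j l IH]; first by apply: dfn_iff dfn_true => e; split.
apply: dfn_iff (dfn_and (dX j) IH) => e; split=> [[Xj Xl] i [<-|/Xl]//|H].
by split=> [|i il]; apply: H; [left|right].
Qed.

Lemma dfn_forall_idx n (X : idx n -> env V M -> Prop) :
  (forall i, dfn (X i)) -> dfn (fun e => forall i, X i e).
Proof.
move=> dX; apply: dfn_iff (@dfn_forall_list _ (idxs n) _ dX) => e.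
split=> H i; [exact: H (In_idxs i)|move=> _; exact: H].
Qed.

End Closure.

Fixpoint tsub (V V' : srt L -> Type) (sg : forall s, V s -> term V' s) s (t : term V s) :
    term V' s :=
  match t with
  | Var s v => sg s v
  | App f ts => App (fun i => tsub sg (ts i))
  end.

Lemma teval_tsub (V V' : srt L -> Type) (sg : forall s, V s -> term V' s) (e : env V' M)
    s (t : term V s) :
  teval e (tsub sg t) = teval (fun s v => teval e (sg s v)) t.
Proof.
elim: t => //= f ts IH; congr fint.
by apply: functional_extensionality_dep => i; exact: IH.
Qed.

Lemma env_ext (V U : srt L -> Type) (e e' : env V U) :
  (forall s v, e s v = e' s v) -> e = e'.
Proof.
move=> ee; apply: functional_extensionality_dep => s.
exact: functional_extensionality_dep.
Qed.

Lemma dfn_tsub (V V' : srt L -> Type) (sg : forall s, V s -> term V' s)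
    (X : env V M -> Prop) :
  dfn X -> dfn (fun e : env V' M => X (fun s v => teval e (sg s v))).
Proof.
move=> [p pP]; apply: (@dfn_iff _ (fun e => holds p (fun s v => teval e (sg s v)))).
  by move=> e; rewrite pP.
move=> {X pP}; elim: p V' sg => {V} [V|V s t u|V r ts|V p IHp q IHq|V s p IH] V' sg /=.
- exact: dfn_bot.
- by apply: dfn_iff (dfn_eq (tsub sg t) (tsub sg u)) => e; rewrite !teval_tsub.
- exists (FRel (fun i => tsub sg (ts i))) => e /=.
  rewrite (_ : (fun i => teval e (tsub sg (ts i))) =
    (fun i => teval (fun s v => teval e (sg s v)) (ts i))) //.
  by apply: functional_extensionality_dep => i; rewrite teval_tsub.
- exact: dfn_imp.
- pose sg' s' (v : vsum V (tvar (arity1 s)) s') : term (vsum V' (tvar (arity1 s))) s' :=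
    match v with
    | inl v => tsub (fun s v => Var (inl v)) (sg _ v)
    | inr x => Var (inr x)
    end.
  apply: dfn_iff (dfn_all (IH _ sg')) => e.
  suff E (m : M s) : (fun s' v => teval (esum e (@tenv _ M (arity1 s) (fun=> m))) (sg' s' v)) =
      esum (fun s v => teval e (sg s v)) (@tenv _ M (arity1 s) (fun=> m)).
    by split=> H m; have := H m; rewrite E.
  by apply: env_ext => s' [v|x] //=; rewrite teval_tsub.
Qed.

Lemma dfn_rename (V V' : srt L -> Type) (r : forall s, V s -> V' s)
    (X : env V M -> Prop) :
  dfn X -> dfn (fun e : env V' M => X (fun s v => e s (r s v))).
Proof. exact: (@dfn_tsub _ _ (fun s v => Var (r s v))). Qed.

Definition tvar_self (S : Type) (a : arity S) s (x : tvar a s) :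
    tvar (arity1 (asort a (vidx x))) s :=
  match x in tvar _ s return tvar (arity1 (asort a (vidx x))) s with
  | TVar i => @TVar _ (arity1 (asort a i)) (exist _ 0 isT)
  end.

Lemma dfn_forall_tuple (V : srt L -> Type) (a : arity (srt L))
    (X : env (vsum V (tvar a)) M -> Prop) :
  dfn X -> dfn (fun e => forall t : tuple_in M a, X (esum e (tenv t))).
Proof.
move=> dX.
(* tv l consists of the coordinates that remain free when those listed in l are
   quantified. *)
pose tv (l : seq (idx (alen a))) s := {x : tvar a s | ~ List.In (vidx x) l}.
have main l : dfn (fun e : env (vsum V (tv l)) M => forall t : tuple_in M a,
    (forall s (x : tv l s), tenv t (sval x) = e s (inr x)) ->
    X (esum (fun s v => e s (inl v)) (tenv t))).
  elim: l => [|i l IH].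
    pose r s (v : vsum V (tvar a) s) : vsum V (tv [::]) s := match v with
      | inl v => inl v | inr x => inr (exist _ x id) end.
    apply: dfn_iff (dfn_rename r dX) => e.
    have E (t : tuple_in M a) : (forall s (x : tv [::] s), tenv t (sval x) = e s (inr x)) ->
        (fun s v => e s (r s v)) = esum (fun s v => e s (inl v)) (tenv t).
      move=> te; apply: env_ext => s [v|x] //=.
      by rewrite /= -te.
    split=> [Xe t te|H]; first by rewrite -(E t te).
    pose t i := e _ (inr (exist (fun x => ~ List.In (vidx x) [::]) (@TVar _ a i) id)).
    have te s (x : tv [::] s) : tenv t (sval x) = e s (inr x).
      case: x => x nx; rewrite (_ : nx = id); last exact: Prop_irrelevance.
      by case: x nx.
    by rewrite (E t te); exact: H.
  (* The coordinate i, unless already in l, becomes the bound variable; the other coordinates stay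
     free. If i is in l, the quantifier is vacuous. *)
  pose r s (v : vsum V (tv l) s) :
      vsum (vsum V (tv (i :: l))) (tvar (arity1 (asort a i))) s := match v with
    | inl v => inl (inl v)
    | inr x => match pselect (vidx (sval x) = i) with
      | left E => inr (eq_rect _ (fun i => tvar (arity1 (asort a i)) s) (tvar_self (sval x)) _ E)
      | right n => inl (inr (exist (fun x => ~ List.In (vidx x) (i :: l)) (sval x)
          (fun h => match h with
          | or_introl E => n (esym E) | or_intror h => svalP x h end)))
      end end.
  have self (t : tuple_in M a) s (x : tvar a s) j (E : vidx x = j) :
      tenv t x = @tenv _ M (arity1 (asort a j)) (fun=> t j) s
        (eq_rect _ (fun i => tvar (arity1 (asort a i)) s) (tvar_self x) _ E).
    by case: _ / E; case: x.
  apply: dfn_iff (dfn_all (dfn_rename r IH)) => e; split=> H.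
    move=> t te; apply: (H (t i)) => s x /=.
    case: pselect => [E|n]; first exact: self.
    by rewrite /= -te.
  move=> m t te /=.
  apply: H => s [x nx] /=.
  have nx' : ~ List.In (vidx x) l by move=> h; apply: nx; right.
  rewrite (te s (exist _ x nx')) /=; case: pselect => [E|n].
    by exfalso; apply: nx; left.
  by rewrite /=; congr (e s (inr _)); congr exist; exact: Prop_irrelevance.
(* Once every coordinate is listed, [tv] is empty and nothing ties t to the environment any more. *)
pose r s (v : vsum V (tv (idxs (alen a))) s) : V s := match v with
  | inl v => v | inr x => match svalP x (In_idxs _) with end end.
apply: dfn_iff (dfn_rename r (main (idxs (alen a)))) => e.
split=> [H t|H t _]; last exact: H.
by apply: H => s [x nx]; case: nx; exact: In_idxs.
Qed.
End Definability.

Lemma In_flatten_map (I T : Type) (F : I -> seq T) (s : seq I) i x :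
  List.In i s -> List.In x (F i) -> List.In x (flatten (map F s)).
Proof.
elim: s => //= j s IH [->|si] Fx; apply/List.in_app_iff; first by left.
by right; exact: IH.
Qed.

Lemma In_pmap (T U : Type) (f : T -> option U) s x y :
  List.In x s -> f x = Some y -> List.In y (pmap f s).
Proof.
elim: s => //= z s IH [->|xs] fx; first by rewrite fx; left.
by case: (f z) => [u|] /=; [right|]; exact: IH.
Qed.

Lemma dchoice (I : Type) (B : I -> Type) (P : forall i, B i -> Prop) :
  (forall i, exists y, P i y) -> exists f : (forall i, B i), forall i, P i (f i).
Proof. by move=> H; exists (fun i => sval (cid (H i))) => i; exact: svalP (cid (H i)). Qed.

(** * Transport of formulas between signatures *)

(* The ingredients of a formula, of which it has finitely many. *)
Definition item (L : signature) (V : srt L -> Type) : Type :=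
  srt L + (fsym L + (rsym L + {s : srt L & V s})).

Definition uses_sort L V s : @item L V := inl s.
Definition uses_fsym L V f : @item L V := inr (inl f).
Definition uses_rsym L V r : @item L V := inr (inr (inl r)).
Definition uses_var L V s v : @item L V := inr (inr (inr (existT V s v))).

(* The maps io identify the sorts of M' with the sorts of M in the image of g.  A
   formula over M is equivalent to one over M' when its items all have
   counterparts in L', its variables being matched by the relation rel. *)
Section Transport.
Variables (L L' : signature) (M : structure L) (M' : structure L').
Variables (g : srt L' -> srt L) (io : forall s, M' s -> M (g s)).

Definition iotup (a : arity (srt L')) (t : tuple_in M' a) : tuple_in M (amap g a) :=
  fun i => io (t i).

Definition ok_sort s := exists s', g s' = s.

(** A counterpart of f is asked for only when its codomain has one: the quotient map onto an
    imaginary sort is available in the reduct as soon as that sort is. *)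
Definition ok_fsym f := forall s', fcod f = g s' ->
  exists (f' : fsym L') (Ed : amap g (fdom f') = fdom f), fcod f' = s' /\
    forall ts, existT M _ (@fint L M f (eq_rect _ (tuple_in M) (iotup ts) _ Ed)) =
      existT M _ (io (@fint L' M' f' ts)).

Definition ok_rsym r :=
  exists (r' : rsym L') (Ed : amap g (rdom r') = rdom r),
    forall ts, @rint L' M' r' ts <-> @rint L M r (eq_rect _ (tuple_in M) (iotup ts) _ Ed).

Section Vars.
Variables (V : srt L -> Type) (V' : srt L' -> Type).
Variable rel : forall s, V (g s) -> V' s -> Prop.

Definition ok (x : item V) : Prop :=
  match x with
  | inl s => ok_sort s
  | inr (inl f) => ok_fsym f
  | inr (inr (inl r)) => ok_rsym r
  | inr (inr (inr v)) => forall s v', v = existT V (g s) v' -> exists w, rel v' w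
  end.

Definition env_rel (e : env V M) (e' : env V' M') : Prop :=
  forall s v v', @rel s v v' -> e _ v = io (e' _ v').

Definition term_rel s (t : term V s) s' (t' : term V' s') : Prop :=
  forall e e', env_rel e e' ->
    existT M s (teval e t) = existT M (g s') (io (teval e' t')).

Definition transportable s (t : term V s) : Prop :=
  forall s', s = g s' -> exists t' : term V' s', term_rel t t'.

Lemma transport_args (a' : arity (srt L')) (a : arity (srt L)) (Ed : amap g a' = a)
    (ts : forall i, term V (asort a i)) : (forall i, transportable (ts i)) ->
  exists ts' : (forall i, term V' (asort a' i)), forall e e', env_rel e e' ->
    (fun i => teval e (ts i)) =
      eq_rect _ (tuple_in M) (iotup (fun i => teval e' (ts' i))) _ Ed.
Proof.
case: _ / Ed ts => ts tr.
have /dchoice[ts' tsP] := fun i => tr i _ erefl.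
exists ts' => e e' ee; apply: functional_extensionality_dep => i.
exact: inj_pair2 (tsP i e e' ee).
Qed.

End Vars.

End Transport.

Lemma tvar1_sort (S : Type) (s s' : S) : tvar (arity1 s) s' -> s = s'.
Proof. by case. Qed.

Section TransportFormula.
Variables (L : signature) (M : structure L).

Lemma transport_term (V : srt L -> Type) s (t : term V s) :
  exists l : seq (item V), forall L' (M' : structure L') (g : srt L' -> srt L)
    (io : forall s, M' s -> M (g s)) V' (rel : forall s, V (g s) -> V' s -> Prop),
    (forall x, List.In x l -> ok io rel x) -> transportable io rel t.
Proof.
elim: t => {s} [s v|f ts IH].
  exists [:: uses_var v] => L' M' g io V' rel okl s' es; subst s.
  have [v' vv'] := okl _ (or_introl erefl) s' v erefl.
  by exists (Var v') => e e' ee /=; rewrite (ee _ _ _ vv').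
have [li liP] := choice IH.
exists (uses_fsym V f :: flatten (map li (idxs _))) => L' M' g io V' rel okl s' es.
have [f' [Ed [es' fP]]] := okl _ (or_introl erefl) _ es; subst s'.
have [|ts' tsP] := @transport_args _ _ _ _ _ io _ _ rel _ _ Ed ts.
  move=> i; apply: liP => x xi; apply: okl; right.
  exact: In_flatten_map (In_idxs i) xi.
by exists (App ts') => e e' ee /=; rewrite -fP (tsP _ _ ee).
Qed.

(** The list l is chosen before the target, so that a subsignature can afterwards be taken large
    enough for all its items. Injectivity of the maps [io] preserves equations, surjectivity
    preserves quantifiers, and injectivity of g matches the sorts of bound variables. *)
Lemma transport_formula (V : srt L -> Type) (p : formula V) :
  exists l : seq (item V), forall L' (M' : structure L') (g : srt L' -> srt L)
    (io : forall s, M' s -> M (g s)) V' (rel : forall s, V (g s) -> V' s -> Prop),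
    injective g -> (forall s, injective (@io s)) -> (forall s m, exists m', @io s m' = m) ->
    (forall x, List.In x l -> ok io rel x) ->
    exists p' : formula V', forall e e', env_rel io rel e e' -> (holds p e <-> holds p' e').
Proof.
elim: p => {V} [V|V s t u|V r ts|V p [lp IHp] q [lq IHq]|V s p [l IH]].
- by exists [::] => L' M' g io V' rel gi ioi ios okl; exists (FBot V').
- have [lt tP] := transport_term t; have [lu uP] := transport_term u.
  exists (uses_sort V s :: lt ++ lu) => L' M' g io V' rel gi ioi ios okl.
  have [s' es] := okl _ (or_introl erefl); subst s.
  have [|t' tt'] := tP L' M' g io V' rel _ s' erefl.
    by move=> x xl; apply: okl; right; apply/List.in_app_iff; left.
  have [|u' uu'] := uP L' M' g io V' rel _ s' erefl.
    by move=> x xl; apply: okl; right; apply/List.in_app_iff; right.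
  exists (FEq t' u') => e e' ee /=.
  rewrite (inj_pair2 _ _ _ _ _ (tt' _ _ ee)) (inj_pair2 _ _ _ _ _ (uu' _ _ ee)).
  by split=> [/ioi|->].
- have [li liP] := choice (fun i => transport_term (ts i)).
  exists (uses_rsym V r :: flatten (map li (idxs _))) => L' M' g io V' rel gi ioi ios okl.
  have [r' [Ed rP]] := okl _ (or_introl erefl).
  have [|ts' tsP] := @transport_args _ _ _ _ _ io _ _ rel _ _ Ed ts.
    move=> i; apply: liP => x xi; apply: okl; right.
    exact: In_flatten_map (In_idxs i) xi.
  by exists (FRel ts') => e e' ee /=; rewrite (tsP _ _ ee) rP.
- exists (lp ++ lq) => L' M' g io V' rel gi ioi ios okl.
  have [|p' pP] := IHp L' M' g io V' rel gi ioi ios.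
    by move=> x xl; apply: okl; apply/List.in_app_iff; left.
  have [|q' qP] := IHq L' M' g io V' rel gi ioi ios.
    by move=> x xl; apply: okl; apply/List.in_app_iff; right.
  by exists (FImp p' q') => e e' ee /=; rewrite (pP _ _ ee) (qP _ _ ee).
(* The bound variable is no item of the quantified formula; its counterpart is provided by [rel']
   below. *)
- pose conv (x : item (vsum V (tvar (arity1 s)))) : option (item V) :=
    match x with
    | inl s => Some (inl s)
    | inr (inl f) => Some (inr (inl f))
    | inr (inr (inl r)) => Some (inr (inr (inl r)))
    | inr (inr (inr (existT s v))) =>
        match v with inl v => Some (uses_var v) | inr _ => None end
    end.
  exists (uses_sort V s :: pmap conv l) => L' M' g io V' rel gi ioi ios okl.
  have [s0 es] := okl _ (or_introl erefl); subst s.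
  pose rel' s' (v : vsum V (tvar (arity1 (g s0))) (g s')) (w : vsum V' (tvar (arity1 s0)) s') :=
    match v, w with
    | inl v, inl w => rel s' v w
    | inr _, inr _ => True
    | _, _ => False
    end.
  have [|p' pP] := IH L' M' g io _ rel' gi ioi ios.
    move=> x xl.
    have okc y : conv x = Some y -> ok io rel y.
      by move=> xy; apply: okl; right; exact: In_pmap xl xy.
    case: x xl okc => [s|[f|[r|[s [v|x]]]]] xl okc; try exact: (okc _ erefl).
      move=> s' v' e; have /= es := congr1 (@projT1 _ _) e; subst s.
      have <- := inj_pair2 _ _ _ _ _ e.
      by have [w vw] := okc _ erefl s' v erefl; exists (inl w).
    move=> s' v' e; have /= es := congr1 (@projT1 _ _) e; subst s.
    have <- := inj_pair2 _ _ _ _ _ e.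
    have es := gi _ _ (tvar1_sort x); subst s'.
    by exists (inr (@TVar _ (arity1 s0) (exist _ 0 isT))).
  exists (FAll p') => e e' ee /=.
  have ee' (m' : M' s0) :
      env_rel io rel' (esum e (@tenv _ M (arity1 (g s0)) (fun=> io _ m')))
        (esum e' (@tenv _ M' (arity1 s0) (fun=> m'))).
    move=> s' [v|x] [w|y] //=; first exact: ee.
    by case: y x => j x; rewrite (_ : x = @TVar _ (arity1 (g s0)) j) //;
      apply: vidx_inj; exact: idx1_eq.
  split=> H m; first by apply/(pP _ _ (ee' m)); exact: H.
  by have [m' <-] := ios _ m; apply/(pP _ _ (ee' m')); exact: H.
Qed.

End TransportFormula.

(** * Large finite subsignatures *)

Section Eventually.
Variable L : signature.
Implicit Types (P Q : subsignature L -> Prop) (S : subsignature L).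

(** A filter: finitely many requirements on a subsignature are combined in it, and sufficiency is
    applied once to their conjunction. *)
Definition eventually P : Prop :=
  exists S0, sub_finite S0 /\ forall S, sub_le S0 S -> P S.

Lemma ev_imp P Q : (forall S, P S -> Q S) -> eventually P -> eventually Q.
Proof. by move=> PQ [S0 [f0 S0P]]; exists S0; split=> // S /S0P /PQ. Qed.

Lemma ev_all P : (forall S, P S) -> eventually P.
Proof.
move=> H; exists (Subsignature set0 set0); split; last by move=> S _; exact: H.
by split; exact: finite_set0.
Qed.

Lemma ev_and P Q : eventually P -> eventually Q -> eventually (fun S => P S /\ Q S).
Proof.
move=> [[F1 R1] [[f1 r1] H1]] [[F2 R2] [[f2 r2] H2]].
exists (Subsignature (F1 `|` F2) (R1 `|` R2)); split.
  by split; rewrite /= finite_setU.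
move=> S [/= sF sR]; split; [apply: H1|apply: H2]; (split=> x xP).
- by apply: sF; left.
- by apply: sR; left.
- by apply: sF; right.
- by apply: sR; right.
Qed.

Lemma ev_list (I : Type) (l : seq I) (P : I -> subsignature L -> Prop) :
  (forall i, List.In i l -> eventually (P i)) ->
  eventually (fun S => forall i, List.In i l -> P i S).
Proof.
elim: l => [|j l IH] H; first exact: ev_all.
have := ev_and (H j (or_introl erefl)) (IH (fun i il => H i (or_intror il))).
by apply: ev_imp => S [Pj Pl] i [<-|/Pl].
Qed.

Lemma ev_idx n (P : idx n -> subsignature L -> Prop) :
  (forall i, eventually (P i)) -> eventually (fun S => forall i, P i S).
Proof.
move=> H; have := @ev_list _ (idxs n) P (fun i _ => H i).
by apply: ev_imp => S PS i; exact: PS (In_idxs i).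
Qed.

Lemma ev_fin (T : finType) (P : T -> subsignature L -> Prop) :
  (forall i, eventually (P i)) -> eventually (fun S => forall i, P i S).
Proof.
move=> H; have := @ev_list _ (enum T) P (fun i _ => H i).
by apply: ev_imp => S PS i; apply: PS; apply: In_mem; rewrite mem_enum.
Qed.

Lemma ev_fsym (f : fsym L) : eventually (fun S => sub_fsym S f).
Proof.
exists (Subsignature [set f] set0); split; first by split; [exact: finite_set1|exact: finite_set0].
by move=> S [/= sf _]; exact: sf.
Qed.

Lemma ev_rsym (r : rsym L) : eventually (fun S => sub_rsym S r).
Proof.
exists (Subsignature set0 [set r]); split; first by split; [exact: finite_set0|exact: finite_set1].
by move=> S [/= _ sr]; exact: sr.
Qed.

Lemma sufficient_ev (W : Type) (Lw : W -> subsignature L) P :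
  sufficient Lw -> eventually P -> exists w, P (Lw w).
Proof. by move=> hW [S0 [f0 H]]; have [w /H] := hW _ f0; exists w. Qed.

Lemma ev_lift_term (V : srt L -> Type) s (t : term V s) :
  eventually (fun S => exists t' : @term (sig_of S) V s, lift_term t' = t).
Proof.
elim: t => {s} [s v|f ts IH]; first by apply: ev_all => S; exists (@Var (sig_of S) V s v).
have := ev_and (ev_fsym f) (ev_idx IH); apply: ev_imp => S [Sf /dchoice[ts' tsP]].
exists (@App (sig_of S) V (exist _ f Sf) ts') => /=; congr App.
exact: functional_extensionality_dep.
Qed.

Lemma ev_lift (V : srt L -> Type) (p : formula V) :
  eventually (fun S => exists p' : @formula (sig_of S) V, lift_formula p' = p).
Proof.
elim: p => {V} [V|V s t u|V r ts|V p IHp q IHq|V s p IH].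
- by apply: ev_all => S; exists (@FBot (sig_of S) V).
- have := ev_and (ev_lift_term t) (ev_lift_term u); apply: ev_imp => S [[t' <-] [u' <-]].
  by exists (@FEq (sig_of S) V s t' u').
- have := ev_and (ev_rsym r) (ev_idx (fun i => ev_lift_term (ts i))).
  apply: ev_imp => S [Sr /dchoice[ts' tsP]].
  exists (@FRel (sig_of S) V (exist _ r Sr) ts') => /=; congr FRel.
  exact: functional_extensionality_dep.
- have := ev_and IHp IHq; apply: ev_imp => S [[p' <-] [q' <-]].
  by exists (@FImp (sig_of S) V p' q').
- by move: IH; apply: ev_imp => S [p' <-]; exists (@FAll (sig_of S) V s p').
Qed.

End Eventually.

Section Reducts.
Variables (L : signature) (M : structure L) (S : subsignature L).

Lemma teval_lift (V : srt L -> Type) s (t : @term (sig_of S) V s) (e : env V M) :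
  teval e (lift_term t) = @teval (sig_of S) (reduct S M) V e s t.
Proof.
elim: t => //= f ts IH; congr fint.
exact: functional_extensionality_dep.
Qed.

Lemma holds_lift (V : srt L -> Type) (p : @formula (sig_of S) V) (e : env V M) :
  holds (lift_formula p) e <-> @holds (sig_of S) (reduct S M) V p e.
Proof.
elim: p e => {V} [V|V s t u|V r ts|V p IHp q IHq|V s p IH] e //=.
- by rewrite !teval_lift.
- rewrite (_ : (fun i => teval e (lift_term (ts i))) =
    (fun i => @teval (sig_of S) (reduct S M) V e _ (ts i))) //.
  by apply: functional_extensionality_dep => i; rewrite teval_lift.
- by rewrite IHp IHq.
- by split=> H m; apply/IH; exact: H.
Qed.

(** [coords] is an inductive family depending on the structure, so its two instances are equal only
    propositionally. *)
Lemma coords_reduct (a : arity (srt L)) (X : set (tuple_in M a)) :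
  @coords (sig_of S) (reduct S M) a X = (@coords L M a X : pset (reduct S M)).
Proof.
apply: functional_extensionality_dep => s; apply: functional_extensionality_dep => m.
by apply: propext; split=> -[t i Xt]; exact: Coords.
Qed.

Lemma sat_lift (A : pset M) (a : arity (srt L))
    (p : @pformula (sig_of S) (reduct S M) (reduct_set A) a) (t : tuple_in M a) :
  @sat L M A a (lift_formula p) t <-> @sat (sig_of S) (reduct S M) (reduct_set A) a p t.
Proof. exact: holds_lift. Qed.

Lemma acl_reduct (A : pset M) s (m : M s) :
  @acl (sig_of S) (reduct S M) (reduct_set A) s m -> acl A m.
Proof.
move=> [p [fp pm]]; exists (lift_formula p); split; last exact/sat_lift.
by apply: (sub_finite_set _ fp) => t /sat_lift.
Qed.

Lemma realizations_reduct (A : pset M) (a : arity (srt L)) (pi : set (pformula A a)) :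
  realizations pi `<=` @realizations _ (reduct S M) _ _ (reduct_type S pi).
Proof. by move=> t pit p /pit /sat_lift. Qed.

End Reducts.

(** * Triviality *)

Section Trivial.
Variables (L : signature) (W : Type) (Lw : W -> subsignature L) (hW : sufficient Lw).
Variables (M : structure L) (A : pset M) (a : arity (srt L)) (pi : set (pformula A a)).

(** Only the formulas [p i] witnessing the hypothesis have to lie in L_w; the conclusion obtained
    there returns to L because algebraicity in a reduct implies algebraicity. *)
Lemma trivial_of_reducts :
  (forall w, trivial (reduct_type (Lw w) pi)) -> trivial pi.
Proof.
move=> hT k u v hu hv hacl.
have [p pP] := dchoice hacl.
have [w wP] := sufficient_ev hW (ev_idx (fun i => ev_lift (p i))).
have [|||i hi] := hT w k u v.
- by move=> i; exact: realizations_reduct.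
- exact: realizations_reduct.
- move=> i; have [p' p'P] := wP i; rewrite coords_reduct; exists p'.
  have [fp pm] := pP i; rewrite -p'P in fp pm.
  split; last by apply/sat_lift.
  by apply: (sub_finite_set _ fp) => t /sat_lift.
- by exists i => j; apply: (@acl_reduct _ _ (Lw w)); have := hi j; rewrite coords_reduct.
Qed.

End Trivial.

(** * Saturation and modular groups *)

Section Saturation.
Variables (K : Type) (hK : card_lt nat K) (L : signature) (M : structure L).

Definition pdfn (P : pset M) (a : arity (srt L)) (X : set (tuple_in M a)) : Prop :=
  exists p : pformula P a, forall t, X t <-> sat p t.

Lemma pdfn_and (P : pset M) a (X Y : set (tuple_in M a)) :
  pdfn P X -> pdfn P Y -> pdfn P (X `&` Y).
Proof.
move=> [p pP] [q qP].
have [r rP] := dfn_and (dfn_holds M p) (dfn_holds M q).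
by exists r => t; rewrite /sat -rP; split=> -[/pP ? /qP ?].
Qed.

Definition listset (l : seq {s : srt L & M s}) : pset M := fun s m => List.In (existT M s m) l.

Lemma small_listset l : small K (listset l).
Proof.
apply: card_lt_embeds hK.
apply (@embeds_of_rel _ _ (fun (c : {s : srt L & params (listset l) s}) n =>
  List.nth_error l n = Some (existT M _ (sval (projT2 c))))).
  by move=> [s [m ml]]; exact: List.In_nth_error ml.
by move=> c c' n /= -> /Some_inj e; apply: params_inj.
Qed.

Lemma small_sub (P Q : pset M) : (forall s m, P s m -> Q s m) -> small K Q -> small K P.
Proof.
move=> PQ; apply: card_lt_embeds.
exists (fun c => existT (params Q) (projT1 c)
  (exist _ (sval (projT2 c)) (PQ _ _ (svalP (projT2 c))))).
move=> c c' e; apply: params_inj.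
exact: (congr1 (fun c => existT M _ (sval (projT2 c))) e).
Qed.

Lemma small_usub (P Q : pset M) : small K P -> small K Q -> small K (usub P Q).
Proof.
move=> hP hQ; apply: card_lt_embeds (card_lt_sum hK hP hQ).
apply: (@embeds_of_rel _ _ (fun (c : {s : srt L & params (usub P Q) s}) d =>
  existT M _ (sval (projT2 c)) = match d with
    | inl d => existT M _ (sval (projT2 d)) | inr d => existT M _ (sval (projT2 d)) end)).
  move=> [s [m [Pm|Qm]]].
    by exists (inl (existT _ s (exist _ m Pm))).
  by exists (inr (existT _ s (exist _ m Qm))).
by move=> c c' d e e'; apply: params_inj; rewrite e e'.
Qed.

Lemma small_coords1 (a : arity (srt L)) (t : tuple_in M a) : small K (coords [set t]).
Proof.
apply: (small_sub _ (@small_listset [seq existT M _ (t i) | i <- idxs (alen a)])) => s m.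
by case=> u i ->; rewrite /listset; apply/List.in_map_iff; exists i; split=> //; exact: In_idxs.
Qed.

Lemma saturated_fip (P : pset M) (a : arity (srt L)) (F : set (set (tuple_in M a))) :
  saturated K M -> small K P -> (forall X, F X -> pdfn P X) ->
  (forall l, (forall X, List.In X l -> F X) -> exists t, forall X, List.In X l -> X t) ->
  exists t, forall X, F X -> X t.
Proof.
move=> satM smallP Fd fip.
pose p : set (pformula P a) := [set q | F [set t | sat q t]].
have [q /finite_set_list[l lP] qp|t tP] := satM P smallP a p.
  have [|t tP] := fip (map (fun q => [set t | sat q t]) l).
    move=> X /List.in_map_iff[r [<- /lP rq]]; exact: qp.
  exists t => r /lP rl.
  have := tP [set t | sat r t]; apply.
  by apply/List.in_map_iff; exists r.
exists t => X FX; have [q qX] := Fd _ FX.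
apply/qX/tP; rewrite /p /= (_ : [set t | sat q t] = X) //.
by apply/seteqP; split=> u /qX.
Qed.

Lemma amap_id (S : Type) (a : arity S) : amap id a = a.
Proof. by case: a. Qed.

Lemma eq_rect_amap_id (a : arity (srt L)) (E : amap id a = a) (t : tuple_in M (amap id a)) :
  eq_rect _ (tuple_in M) t _ E = t.
Proof. by case: a E t => n f E t; rewrite (_ : E = erefl) //; exact: Prop_irrelevance. Qed.

(** Transport from M to itself along the identity, changing only the set of parameters. It brings a
    formula with arbitrary parameters from M over a finite set, as saturation requires a small
    one. *)
Lemma pdfn_finite_params (a : arity (srt L)) (X : set (tuple_in M a)) :
  pdfn (@fullset L M) X -> exists l, forall P : pset M,
    (forall s m, listset l m -> P s m) -> pdfn P X.
Proof.
move=> [p pX]; have [l lP] := transport_formula M p.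
pose conv (x : item (vsum (tvar a) (params (@fullset L M)))) : option {s : srt L & M s} :=
  match x with
  | inr (inr (inr (existT s v))) =>
      match v with inr c => Some (existT M s (sval c)) | inl _ => None end
  | _ => None
  end.
exists (pmap conv l) => P lsP.
pose rel s (v : vsum (tvar a) (params (@fullset L M)) (id s)) (w : vsum (tvar a) (params P) s) :=
  match v, w with
  | inl x, inl y => x = y
  | inr c, inr d => sval c = sval d
  | _, _ => False
  end.
have [| | | |q qP] := lP L M id (fun s m => m) _ rel.
- exact: inj_id.
- by move=> s; exact: inj_id.
- by move=> s m; exists m.
- move=> [s|[f|[r|[s v]]]] xl.
  + by exists s.
  + move=> s' es; exists f, (amap_id (fdom f)); split=> // ts.
    by rewrite eq_rect_amap_id.
  + by exists r, (amap_id (rdom r)) => ts; rewrite eq_rect_amap_id.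
  + move=> s' v' e; have es : s = s' := congr1 (@projT1 _ _) e.
    subst s'; have ev := inj_pair2 _ _ _ _ _ e; subst v'.
    case: v xl {e} => [x|c] xl; first by exists (inl x).
    have Pc : P s (sval c) by apply: lsP; exact: In_pmap xl erefl.
    by exists (inr (exist _ _ Pc)).
exists q => t; rewrite pX; apply: qP => s [x|c] [y|d] //=; by move=> ->.
Qed.

Lemma realize_in_type (A : pset M) (a : arity (srt L)) (pi : set (pformula A a))
    (X : set (tuple_in M a)) :
  saturated K M -> small K A -> pdfn (@fullset L M) X ->
  (forall q, (forall p, List.In p q -> pi p) ->
    exists t, X t /\ forall p, List.In p q -> sat p t) ->
  exists t, X t /\ realizations pi t.
Proof.
move=> satM smallA /pdfn_finite_params[l lP] H.
pose F : set (set (tuple_in M a)) :=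
  [set Y | Y = X \/ exists p, pi p /\ Y = [set t | sat p t]].
have [||k kF|t tF] := @saturated_fip (usub A (listset l)) a F satM.
- exact/small_usub/small_listset.
- move=> Y [->|[p [_ ->]]]; first by apply: lP => s m; right.
  pose r s (v : vsum (tvar a) (params A) s) :
      vsum (tvar a) (params (usub A (listset l))) s :=
    match v with inl x => inl x | inr c => inr (exist _ (sval c) (or_introl (svalP c))) end.
  have [q qP] := dfn_rename r (dfn_holds M p).
  exists q => t; rewrite /sat -qP /= /sat.
  set e1 := esum _ _; set e2 := (X in _ <-> holds p X).
  by rewrite (_ : e2 = e1) //; apply: env_ext => s [x|c].
(* A finite part of F is implied by X together with finitely many formulas of pi. *)
- have [q [qpi qP]] : exists q, (forall p, List.In p q -> pi p) /\
      forall t, X t -> (forall p, List.In p q -> sat p t) -> forall Y, List.In Y k -> Y t.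
    elim: k kF => [|Y k IH] kF; first by exists [::].
    have [q [qpi qP]] := IH (fun Z Zk => kF Z (or_intror Zk)).
    have [->|[p [pip ->]]] := kF Y (or_introl erefl).
      by exists q; split=> // t Xt tq Z [<-//|]; exact: qP.
    exists (p :: q); split=> [r [<-//|]|t Xt tq Z [<-|]].
    + exact: qpi.
    + by apply: tq; left.
    + by apply: qP => // r rq; apply: tq; right.
  by have [t [Xt tq]] := H q qpi; exists t; exact: qP.
exists t; split; first by apply: tF; left.
by move=> p pip; apply: (tF [set t | sat p t]); right; exists p.
Qed.

(** In each of the three places, [inl c] puts the constant c and [inr tt] the variable t. *)
Lemma definable3_inst (a : arity (srt L)) R (bx by_ bz : tuple_in M a + unit) :
  definable3 M a R ->
  let val b t := if b is inl c then c else t in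
  pdfn (@fullset L M) [set t | R (val bx t) (val by_ t) (val bz t)].
Proof.
move=> [p pR] val.
pose r1 (b : tuple_in M a + unit) s (x : tvar a s) : vsum (tvar a) (params (@fullset L M)) s :=
  if b is inl c then inr (exist _ (tenv c x) I) else inl x.
pose r s (v : vsum (tvar a) (vsum (tvar a) (vsum (tvar a) (params (@fullset L M)))) s) :=
  match v with
  | inl x => r1 bx s x
  | inr (inl x) => r1 by_ s x
  | inr (inr (inl x)) => r1 bz s x
  | inr (inr (inr c)) => inr c
  end.
have [q qP] := dfn_rename r (dfn_holds M p).
exists q => t; rewrite /sat -qP /= pR.
set e1 := esum _ _; set e2 := (X in _ <-> holds p X).
have r1P b s (x : tvar a s) : esum (tenv t) (@penv L M _) (r1 b s x) = tenv (val b t) x.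
  by case: b.
by rewrite (_ : e2 = e1) //; apply: env_ext => s [x|[x|[x|c]]] //; exact: r1P.
Qed.

End Saturation.

Section ModularGroup.
Variables (K : Type) (hK : card_lt nat K).
Variables (L : signature) (W : Type) (Lw : W -> subsignature L) (hW : sufficient Lw).
Variables (M : structure L) (A : pset M) (a : arity (srt L)) (pi : set (pformula A a)).
Hypotheses (satM : saturated K M) (smallA : small K A).
Variable R : tuple_in M a -> tuple_in M a -> tuple_in M a -> Prop.
Hypotheses (Rdef : definable3 M a R).
Hypothesis modw : forall w, definable3 (reduct (Lw w) M) a R ->
  modular_group (reduct_type (Lw w) pi) R.

Let G := realizations pi.
Let Gr (S : subsignature L) : set (tuple_in M a) := @realizations _ (reduct S M) _ _ (reduct_type S pi).

Let subG (S : subsignature L) : G `<=` Gr S.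
Proof. exact: realizations_reduct. Qed.

Let Rdef_ev : eventually (fun S => definable3 (reduct S M) a R).
Proof.
have [p pR] := Rdef; have := ev_lift p; apply: ev_imp => S [p' pp'].
by exists p' => x y z; rewrite pR -pp'; exact: holds_lift.
Qed.

Lemma modular_reduct (P : subsignature L -> Prop) : eventually P -> exists w, P (Lw w) /\
  modular_group (reduct_type (Lw w) pi) R.
Proof.
move=> evP; have [w [Pw Rw]] := sufficient_ev hW (ev_and evP Rdef_ev).
by exists w; split=> //; exact: modw.
Qed.

Lemma group_reduct : exists S, group_on R (Gr S).
Proof.
by have [w [_ [_ gw _]]] := modular_reduct (ev_all (fun _ => I)); exists (Lw w).
Qed.

(* The subsignatures need not be directed, so that products computed in two of
   the groups Gr S may differ; saturation provides one lying in all of them. *)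
Lemma realize_in_group (X : set (tuple_in M a)) : pdfn (@fullset L M) X ->
  (forall S, group_on R (Gr S) -> exists t, X t /\ Gr S t) -> exists2 t, G t & X t.
Proof.
move=> Xd H; have [|t [Xt Gt]] := realize_in_type hK satM smallA Xd (pi := pi); last by exists t.
move=> q qpi.
have [w [wq [_ gw _]]] := modular_reduct (ev_list (fun p (_ : List.In p q) => ev_lift p)).
have [t [Xt Gt]] := H _ gw; exists t; split=> // p pq.
have [p' p'p] := wq p pq; rewrite -p'p; apply/sat_lift; apply: Gt.
by rewrite /reduct_type /= p'p; exact: qpi.
Qed.

Lemma group_on_realizations : group_on R G.
Proof.
have [S0 g0] := group_reduct.
have inst bx by_ bz := definable3_inst bx by_ bz Rdef.
split.
- move=> x y Gx Gy.
  have [S gS|z Gz Rz] := realize_in_group (inst (inl x) (inl y) (inr tt)).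
    by have [z Gz Rz] := group_mul gS (subG Gx) (subG Gy); exists z.
  exists z; split=> // z' [Gz' Rz'].
  exact: (group_fun g0 (subG Gx) (subG Gy) (subG Gz) (subG Gz') Rz Rz').
- by move=> x y z u v p Gx Gy Gz Gu Gv Gp; apply: (group_assoc g0); exact: subG.
(* The unit is the only idempotent, a description common to all the groups Gr S. *)
- have [S gS|e Ge Ree] := realize_in_group (inst (inr tt) (inr tt) (inr tt)).
    have [_ _ [e [Ge eP]]] := gS; exists e; split=> //=.
    by have [] := eP _ Ge.
  have eU S (gS : group_on R (Gr S)) : unit_of R (Gr S) e.
    by apply: idempotent_unit => //; exact: subG.
  exists e; split=> // x Gx; have [R1 R2 _] := (eU _ g0).2 _ (subG Gx); split=> //.
  (* As e is the unit of every group [Gr S], being an inverse of x is the same definable condition,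
     with parameters x and e, in all of them. *)
  have [S gS|y Gy [Rxy Ryx]] := realize_in_group
      (pdfn_and (inst (inl x) (inr tt) (inl e)) (inst (inr tt) (inl x) (inl e))).
    by have [_ _ [y [Gy Rxy Ryx]]] := (eU _ gS).2 _ (subG Gx); exists y.
  by exists y.
Qed.

Lemma modular_group_of_reducts : modular_group pi R.
Proof.
have gG := group_on_realizations.
split=> // D [DG [p pD]].
have [w [[p' p'p] [_ gw modw']]] := modular_reduct (ev_lift p).
set F := [set X | _].
pose D' := [set t | Gr (Lw w) t /\ sat p t].
have -> : D = D' `&` realizations pi.
  apply/seteqP; split=> t; last by move=> [[_ pt] Gt]; apply/pD.
  by move=> Dt; have Gt := DG _ Dt; split=> //; split; [exact: subG|apply/pD].
(* The group is a coset of itself. Its complement provides the empty set, needed for the cosets that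
   miss it. *)
have wholeF : F (realizations pi).
  have [_ _ [e [Ge eP]]] := gG.
  exists (realizations pi), e; split=> //; first by split.
    by split=> //; exists (FImp (FBot _) (FBot _)) => x Gx; split=> // _; rewrite /sat /=.
  apply/seteqP; split=> z; last by case.
  by move=> Gz; split=> //; exists z; split=> //; have [] := eP _ Gz.
apply: (@boolean_combination_setI _ _ _ (@subG (Lw w)) _ _ _ _ (modw' D' _)).
  move=> X [H [g [sH [_ [q qH]] Gg ->]]].
  case: (pselect (exists g', coset R (Gr (Lw w)) H g g' /\ G g')) => [[g' [cg' Gg']]|nc].
    rewrite (coset_setI gw gG (@subG (Lw w)) sH Gg cg' Gg').
    apply: BCbase; exists (H `&` realizations pi), g'; split=> //.
      exact: (subgroup_setI gw gG (@subG (Lw w)) sH).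
    split; first exact: subIsetr.
    exists (lift_formula q) => x Gx; split.
      by move=> [Hx _]; apply/sat_lift/qH => //; exact: subG.
    by move=> /sat_lift qx; split=> //; apply/qH => //; exact: subG.
  have -> : coset R (Gr (Lw w)) H g `&` realizations pi = realizations pi `\` realizations pi.
    rewrite setDv; apply/seteqP; split=> // z [cz Gz].
    by apply: nc; exists z.
  by apply: BCcompl; apply: BCbase.
split; first by move=> t [].
exists p' => t Gt; rewrite /D' /= -p'p; split=> [[_ /sat_lift]//|pt].
by split=> //; apply/sat_lift.
Qed.

End ModularGroup.

(** * Reducts of M^eq *)

Section LiftInjective.
Variables (L : signature) (S : subsignature L) (X : Type).
Variables (cs : srt L -> X) (cf : fsym L -> X) (cr : rsym L -> X).

Lemma enc_lift_term (V : srt L -> Type) (vc : forall s, V s -> GenTree.tree X) s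
    (t : @term (sig_of S) V s) :
  enc_term cf vc (lift_term t) = @enc_term (sig_of S) X (fun f => cf (sval f)) V vc s t.
Proof. by elim: t => //= f ts IH; congr (_ _ (_ :: _)); apply: eq_map. Qed.

Lemma enc_lift (V : srt L -> Type) (p : @formula (sig_of S) V)
    (vc : forall s, V s -> GenTree.tree X) :
  enc cs cf cr (lift_formula p) vc =
  @enc (sig_of S) X cs (fun f => cf (sval f)) (fun r => cr (sval r)) V p vc.
Proof.
elim: p vc => {V} [V|V s t u|V r ts|V p IHp q IHq|V s p IH] vc //=.
- by rewrite !enc_lift_term.
- by congr (_ _ (_ :: _)); apply: eq_map => i; rewrite enc_lift_term.
- by rewrite IHp IHq.
- by rewrite IH.
Qed.

End LiftInjective.

(** Lifting preserves codes, and codes are injective. As a consequence, distinct imaginary sorts of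
    the reduct remain distinct sorts of M^eq. *)
Lemma lift_formula_inj (L : signature) (S : subsignature L) (V : srt L -> Type) (Y : Type)
    (vc : forall s, V s -> Y) : (forall s, injective (vc s)) ->
  injective (@lift_formula L S V).
Proof.
move=> vci p q e.
pose X : Type := srt L + (fsym L + (rsym L + Y)).
pose cs (s : srt L) : X := inl s.
pose cf (f : fsym L) : X := inr (inl f).
pose cr (r : rsym L) : X := inr (inr (inl r)).
pose v s x := @GenTree.Leaf X (inr (inr (inr (vc s x)))).
have := congr1 (fun p => enc cs cf cr p v) e; rewrite !enc_lift.
apply: enc_inj.
- by move=> ? ? [].
- by move=> f f' [] /sval_inj.
- by move=> f f' [] /sval_inj.
- by move=> s x y [] /vci.
Qed.

Section EqReduct.
Variables (L : signature) (M : structure L) (S : subsignature L).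
Notation MS := (reduct S M).

Lemma sat2_lift a d (p : @formula2 (sig_of S) a d) (t : tuple_in M a) (u : tuple_in M d) :
  @sat2 L M a d (lift_formula p) t u <-> @sat2 (sig_of S) MS a d p t u.
Proof. exact: holds_lift. Qed.

Definition lift_eqrel (th : eqrel MS) : eqrel M :=
  @EqRel L M (eqrel_arity th) (lift_formula (eqrel_form th))
    (fun t => (sat2_lift (eqrel_form th) t t).2 (@eqrel_refl _ _ th t))
    (fun t u h => (sat2_lift (eqrel_form th) u t).2
      (@eqrel_sym _ _ th _ _ ((sat2_lift (eqrel_form th) t u).1 h)))
    (fun t u v h h' => (sat2_lift (eqrel_form th) t v).2
      (@eqrel_trans _ _ th _ _ _ ((sat2_lift (eqrel_form th) t u).1 h)
        ((sat2_lift (eqrel_form th) u v).1 h'))).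

Lemma lift_eqrel_inj : injective lift_eqrel.
Proof.
move=> [a p r s t] [a' p' r' s' t'] e.
have {}e := congr1 (fun th => existT (fun a => formula2 a a) _ (eqrel_form th)) e.
have ea : a = a' := congr1 (@projT1 _ _) e.
subst a'; have {}e := inj_pair2 _ _ _ _ _ e; apply: eqrel_eq => /=; congr existT.
move: e; rewrite /=.
apply: (@lift_formula_inj _ _ _ (nat + nat)%type (fun s v =>
  match v with inl x => inl (sval (vidx x)) | inr x => inr (sval (vidx x)) end)).
by move=> s0 [x|x] [y|y] //= [e]; rewrite (@vidx_inj _ _ _ x y) //; exact: sval_inj e.
Qed.

Definition geq (s : srt (eq_signature MS)) : srt (eq_signature M) :=
  match s with inl s => inl s | inr th => inr (lift_eqrel th) end.

Lemma geq_inj : injective geq.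
Proof.
case=> [s|th] [s'|th'] //= e; first by case: e => ->.
by congr inr; apply: lift_eqrel_inj; exact: inr_inj e.
Qed.

Lemma eq_class_lift (th : eqrel MS) (t : tuple_in M (eqrel_arity th)) :
  @eq_class L M (lift_eqrel th) t = @eq_class (sig_of S) MS th t.
Proof.
apply: functional_extensionality_dep => u; apply: propext.
exact: (sat2_lift (eqrel_form th) t u).
Qed.

Lemma eq_carrier_lift (th : eqrel MS) (C : tuple_in M (eqrel_arity th) -> Prop) :
  (exists t, C = @eq_class (sig_of S) MS th t) <->
  (exists t, C = @eq_class L M (lift_eqrel th) t).
Proof.
by split=> -[t ->]; exists t; rewrite (eq_class_lift t).
Qed.

(** Both sorts have the same classes as elements; only the proof of being a class changes. *)
Definition ioq (s : srt (eq_signature MS)) : Meq MS s -> Meq M (geq s) :=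
  match s return Meq MS s -> Meq M (geq s) with
  | inl s => fun m => m
  | inr th => fun C => exist _ (sval C) ((eq_carrier_lift (sval C)).1 (svalP C))
  end.

Lemma ioq_inj s : injective (@ioq s).
Proof. by case: s => [s|th] //= C C' [] /sval_inj. Qed.

Lemma ioq_surj s (m : Meq M (geq s)) : exists m', ioq m' = m.
Proof.
case: s m => [s|th] /= m; first by exists m.
by exists (exist _ (sval m) ((eq_carrier_lift (sval m)).2 (svalP m))); apply: sval_inj.
Qed.

End EqReduct.

Section EqReductEv.
Variables (L : signature) (M : structure L).

Lemma ev_ok_sort (s : srt (eq_signature M)) :
  eventually (fun S => ok_sort (@geq L M S) s).
Proof.
case: s => [s|th]; first by apply: ev_all => S; exists (inl s).
have := ev_lift (eqrel_form th); apply: ev_imp => S [p' pp'].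
have pP t u := @sat2_lift L M S _ _ p' t u; rewrite pp' in pP.
exists (inr (@EqRel (sig_of S) (reduct S M) (eqrel_arity th) p'
  (fun t => (pP t t).1 (@eqrel_refl _ _ th t))
  (fun t u h => (pP u t).1 (@eqrel_sym _ _ th _ _ ((pP t u).2 h)))
  (fun t u v h h' => (pP t v).1 (@eqrel_trans _ _ th _ _ _ ((pP t u).2 h) ((pP u v).2 h'))))) => /=.
by congr inr; apply: eqrel_eq; rewrite /= pp'.
Qed.

Lemma ev_ok_fsym (f : fsym (eq_signature M)) :
  eventually (fun S => ok_fsym (@ioq L M S) f).
Proof.
case: f => [f|th].
  have := ev_fsym f; apply: ev_imp => S Sf s' es.
  by exists (inl (exist _ f Sf)), erefl; split=> //; apply: (@geq_inj _ M S); rewrite -es.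
apply: ev_all => S [//|th'] [eth]; subst th.
exists (inr th'), erefl; split=> // ts /=.
congr existT; apply: sval_inj => /=.
exact: eq_class_lift.
Qed.

Lemma ev_ok_rsym (r : rsym (eq_signature M)) :
  eventually (fun S => ok_rsym (@ioq L M S) r).
Proof.
by have := @ev_rsym L r; apply: ev_imp => S Sr; exists (exist _ r Sr), erefl.
Qed.

Lemma ev_arity (a : arity (srt (eq_signature M))) :
  eventually (fun S => exists a', amap (@geq L M S) a' = a).
Proof.
have := ev_idx (fun i => ev_ok_sort (asort a i)); apply: ev_imp => S /dchoice[f fP].
exists (Arity f); case: a f fP => n h f fP; congr Arity.
exact: functional_extensionality_dep.
Qed.

(** Sorts and symbols of p are taken care of by making S large. The variables, which include
    parameters, remain a condition on [rel], to be met by each use. *)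
Lemma ev_formula (V : srt (eq_signature M) -> Type) (p : formula V) :
  exists lv : seq {s & V s}, eventually (fun S => forall V' rel,
    (forall x, List.In x lv -> forall s v', x = existT V (@geq L M S s) v' ->
      exists w, rel s v' w) ->
    exists p' : @formula (eq_signature (reduct S M)) V', forall e e',
      @env_rel _ _ _ _ _ (@ioq L M S) V V' rel e e' -> (holds p e <-> holds p' e')).
Proof.
have [l lP] := transport_formula (Meq M) p.
exists (pmap (fun x : item V => match x with inr (inr (inr v)) => Some v | _ => None end) l).
have : eventually (fun S => forall x, List.In x l -> match x with
    | inl s => ok_sort (@geq L M S) s
    | inr (inl f) => ok_fsym (@ioq L M S) f
    | inr (inr (inl r)) => ok_rsym (@ioq L M S) r
    | inr (inr (inr v)) => True end).
  apply: ev_list => -[s|[f|[r|v]]] _.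
  - exact: ev_ok_sort.
  - exact: ev_ok_fsym.
  - exact: ev_ok_rsym.
  - exact: ev_all.
apply: ev_imp => S okl V' rel okv.
apply: (lP _ _ _ (@ioq L M S) V' rel).
- exact: geq_inj.
- exact: ioq_inj.
- exact: ioq_surj.
- move=> x xl; have := okl x xl; case: x xl => [s|[f|[r|v]]] xl //= _.
  by apply: okv; exact: In_pmap xl erefl.
Qed.

End EqReductEv.

Section EqTransfer.
Variables (L : signature) (M : structure L).
Notation io S := (@iotup _ _ (Meq M) (Meq (reduct S M)) (@geq L M S) (@ioq L M S) _).
Notation cast E t := (eq_rect _ (tuple_in (Meq M)) t _ E).

Lemma tvar_sort (S : Type) (a : arity S) s (x : tvar a s) : asort a (vidx x) = s.
Proof. by case: x. Qed.

Lemma tvar_amap S a' s (x : tvar (amap (@geq L M S) a') (geq s)) :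
  exists y : tvar a' s, vidx x = vidx y.
Proof.
have es : asort a' (vidx x) = s by apply: (@geq_inj L M S); exact: tvar_sort x.
have vE i s' (E : asort a' i = s') : vidx (eq_rect _ (tvar a') (TVar i) s' E) = i.
  by case: _ / E.
by exists (eq_rect _ (tvar a') (@TVar _ a' (vidx x)) _ es); rewrite vE.
Qed.

Lemma tenv_iotup S a' s (x : tvar (amap (@geq L M S) a') (geq s)) (y : tvar a' s)
    (t : tuple_in (Meq (reduct S M)) a') :
  vidx x = vidx y -> tenv (io S t) x = ioq (tenv t y).
Proof.
by case: y x => i x e; rewrite (_ : x = @TVar _ (amap (@geq L M S) a') i) //; exact: vidx_inj.
Qed.

(** The set of parameters may vary with S, as acl^eq in the reduct does. Each parameter of p is
    available for large S, and p has finitely many. *)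
Lemma ev_pformula (P : pset (Meq M)) (P' : forall S, pset (Meq (reduct S M)))
    (a : arity (srt (eq_signature M))) (p : pformula P a) :
  (forall s e, P s e -> eventually (fun S => forall s' m,
     existT (Meq M) s e = existT (Meq M) (geq s') (ioq m) -> P' S s' m)) ->
  eventually (fun S => forall a' (E : amap (@geq L M S) a' = a),
    exists p' : pformula (P' S) a', forall t, sat p (cast E (io S t)) <-> sat p' t).
Proof.
move=> hP; have [lv evp] := ev_formula p.
have evl : eventually (fun S => forall x, List.In x lv -> match projT2 x with
    | inl _ => True
    | inr c => forall s' m, existT (Meq M) (projT1 x) (sval c) =
        existT (Meq M) (geq s') (ioq m) -> P' S s' m end).
  by apply: ev_list => -[s [x|c]] _ /=; [exact: ev_all|exact: hP (svalP c)].
have := ev_and evl evp; apply: ev_imp => S [okl H] a' E.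
subst a => /=.
pose rel s (v : vsum (tvar (amap (@geq L M S) a')) (params P) (geq s))
    (w : vsum (tvar a') (params (P' S)) s) :=
  match v, w with
  | inl x, inl y => vidx x = vidx y
  | inr c, inr d => sval c = ioq (sval d)
  | _, _ => False
  end.
have [|p' pP] := H _ rel.
  move=> x xl s v' ex; have := okl _ xl; subst x => /=.
  case: v' {xl} => [x _|c Pc].
    by have [y xy] := tvar_amap x; exists (inl y).
  have [m mc] := ioq_surj (sval c).
  by exists (inr (exist _ m (Pc _ _ (congr1 _ (esym mc))))).
exists p' => t; apply: pP => s [x|c] [y|d] //= xy; exact: tenv_iotup.
Qed.

Lemma ev_formula2 (a d : arity (srt (eq_signature M))) (p : formula2 a d) :
  eventually (fun S => forall a' d' (Ea : amap (@geq L M S) a' = a)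
      (Ed : amap (@geq L M S) d' = d),
    exists p' : formula2 a' d', forall t u,
      sat2 p (cast Ea (io S t)) (cast Ed (io S u)) <-> sat2 p' t u).
Proof.
have [lv evp] := ev_formula p; move: evp; apply: ev_imp => S H a' d' Ea Ed.
subst a d => /=.
pose rel s (v : vsum (tvar (amap (@geq L M S) a')) (tvar (amap (@geq L M S) d')) (geq s))
    (w : vsum (tvar a') (tvar d') s) :=
  match v, w with
  | inl x, inl y => vidx x = vidx y
  | inr x, inr y => vidx x = vidx y
  | _, _ => False
  end.
have [|p' pP] := H _ rel.
  move=> x xl s v' _; case: v' => x'; have [y xy] := tvar_amap x'.
    by exists (inl y).
  by exists (inr y).
by exists p' => t u; apply: pP => s [x|x] [y|y] //= xy; exact: tenv_iotup.
Qed.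

Section Lift.
Variable S : subsignature L.
Notation MS := (reduct S M).

(** The upward direction, valid for every S: each sort and symbol of the imaginary signature of the
    reduct has a counterpart in L^eq. *)
Lemma lift_eq_term (V' : srt (eq_signature MS) -> Type) (V : srt (eq_signature M) -> Type)
    (r : forall s, V' s -> V (geq s)) s (t : term V' s) :
  exists t0 : term V (geq s), forall (e : env V (Meq M)) (e' : env V' (Meq MS)),
    (forall s v, e _ (r s v) = ioq (e' s v)) -> teval e t0 = ioq (teval e' t).
Proof.
elim: t => {s} [s v|[f|th] ts /dchoice[ts0 tsP]].
- by exists (Var (r _ v)) => e e' ee; exact: ee.
- exists (@App (eq_signature M) V (inl (sval f)) ts0) => e e' ee /=.
  rewrite (_ : (fun i => teval e (ts0 i)) = (fun i => teval e' (ts i))) //.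
  by apply: functional_extensionality_dep => i; exact: tsP.
- exists (@App (eq_signature M) V (inr (lift_eqrel th)) ts0) => e e' ee /=.
  apply: sval_inj => /=; rewrite -eq_class_lift.
  rewrite (_ : (fun i => teval e (ts0 i)) = (fun i => teval e' (ts i))) //.
  by apply: functional_extensionality_dep => i; exact: tsP.
Qed.

Lemma lift_eq_formula (V' : srt (eq_signature MS) -> Type) (p : formula V') :
  forall (V : srt (eq_signature M) -> Type) (r : forall s, V' s -> V (geq s)),
  exists p0 : formula V, forall (e : env V (Meq M)) (e' : env V' (Meq MS)),
    (forall s v, e _ (r s v) = ioq (e' s v)) -> (holds p0 e <-> holds p e').
Proof.
elim: p => {V'} [V'|V' s t u|V' R ts|V' p IHp q IHq|V' s p IH] V r.
- by exists (FBot V).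
- have [t0 tP] := lift_eq_term r t; have [u0 uP] := lift_eq_term r u.
  exists (FEq t0 u0) => e e' ee /=; rewrite (tP _ _ ee) (uP _ _ ee).
  by split=> [/ioq_inj|->].
- have /dchoice[ts0 tsP] := fun i => lift_eq_term r (ts i).
  exists (@FRel (eq_signature M) V (sval R) ts0) => e e' ee /=.
  rewrite (_ : (fun i => teval e (ts0 i)) = (fun i => teval e' (ts i))) //.
  by apply: functional_extensionality_dep => i; exact: tsP.
- have [p0 pP] := IHp V r; have [q0 qP] := IHq V r.
  by exists (FImp p0 q0) => e e' ee /=; rewrite (pP _ _ ee) (qP _ _ ee).
- pose r' s' (v : vsum V' (tvar (arity1 s)) s') : vsum V (tvar (arity1 (geq s))) (geq s') :=
    match v with
    | inl v => inl (r _ v)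
    | inr x => inr (match x with TVar i => @TVar _ (arity1 (geq s)) i end)
    end.
  have [p0 pP] := IH _ r'; exists (FAll p0) => e e' ee /=.
  have ee' (m : Meq MS s) s' v :
      esum e (@tenv _ (Meq M) (arity1 (geq s)) (fun=> ioq m)) (r' s' v) =
      ioq (esum e' (@tenv _ (Meq MS) (arity1 s) (fun=> m)) v).
    by case: v => [v|[i]] //=; exact: ee.
  split=> H m; first by apply/(pP _ _ (ee' m)); exact: H.
  by have [m' <-] := ioq_surj m; apply/(pP _ _ (ee' m')); exact: H.
Qed.

Lemma lift_eq_pformula (P' : pset (Meq MS)) (P : pset (Meq M)) a'
    (p : pformula P' a') : (forall s m, P' s m -> P _ (ioq m)) ->
  exists p0 : pformula P (amap (@geq L M S) a'), forall t, sat p0 (io S t) <-> sat p t.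
Proof.
move=> PP.
pose r s (v : vsum (tvar a') (params P') s) :
    vsum (tvar (amap (@geq L M S) a')) (params P) (geq s) :=
  match v with
  | inl x => inl (match x with TVar i => @TVar _ (amap (@geq L M S) a') i end)
  | inr c => inr (exist _ (ioq (sval c)) (PP _ _ (svalP c)))
  end.
have [p0 pP] := lift_eq_formula p r.
by exists p0 => t; apply: pP => s [[i]|c].
Qed.

Lemma same_type_reduct (P' : pset (Meq MS)) (P : pset (Meq M)) a'
    (t u : tuple_in (Meq MS) a') : (forall s m, P' s m -> P _ (ioq m)) ->
  same_type P (io S t) (io S u) -> same_type P' t u.
Proof.
move=> PP tu p; have [p0 pP] := lift_eq_pformula p PP.
by rewrite -!pP; exact: tu.
Qed.

Lemma iotup_inj a' : injective (@iotup _ _ (Meq M) (Meq MS) _ (@ioq L M S) a').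
Proof.
move=> t u e; apply: functional_extensionality_dep => i; apply: ioq_inj.
exact: (congr1 (fun f => f i) e).
Qed.

Lemma iotup_surj a' (t : tuple_in (Meq M) (amap (@geq L M S) a')) :
  exists t', io S t' = t.
Proof.
have /dchoice[t' tP] := fun i => ioq_surj (t i).
exists t'; exact: functional_extensionality_dep.
Qed.

Lemma acl_ioq (P' : pset (Meq MS)) (P : pset (Meq M)) s (m : Meq MS s) :
  (forall s m, P' s m -> P _ (ioq m)) -> acl P' m -> acl P (ioq m).
Proof.
move=> PP [p [fp pm]]; have [p0 pP] := lift_eq_pformula p PP.
exists p0; split; last by apply/(pP (fun=> m)).
refine (@sub_finite_set (tuple_in (Meq M) (arity1 (geq s))) _ _ _
  (finite_image (io S) fp)) => t p0t.
have [t' tt'] := iotup_surj (a' := arity1 s) t.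
by exists t' => //=; apply/pP; rewrite tt'.
Qed.

Lemma acleq_ioq (Q : pset M) s (m : Meq MS s) :
  @acleq (sig_of S) MS Q s m -> @acleq L M Q _ (ioq m).
Proof. by apply: acl_ioq => -[s'|th] m'. Qed.

End Lift.

(** The formula witnessing algebraicity has parameters in home sorts, which every reduct shares. Its
    solutions in the reduct inject into those in M^eq, so they stay finite in number. *)
Lemma ev_acleq (Q : pset M) s (e : Meq M s) : acleq Q e ->
  eventually (fun S => forall s' (m : Meq (reduct S M) s'),
    existT (Meq M) s e = existT (Meq M) (geq s') (ioq m) ->
    @acleq (sig_of S) (reduct S M) Q s' m).
Proof.
move=> [p [fp pe]].
have := @ev_pformula _ (fun S => @home (sig_of S) (reduct S M) Q) _ p.
have hQ s0 e0 : home Q e0 -> eventually (fun S => forall s' m,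
    existT (Meq M) s0 e0 = existT (Meq M) (geq s') (ioq m) ->
    @home (sig_of S) (reduct S M) Q s' m).
  case: s0 e0 => // s0 e0 Qe; apply: ev_all => S [s'|th] m //= em.
  have [es] := congr1 (@projT1 _ _) em; subst s'.
  by have <- := inj_pair2 _ _ _ _ _ em.
move=> /(_ hQ); apply: ev_imp => S H s' m em.
have es : s = geq s' := congr1 (@projT1 _ _) em.
subst s; have {}em := inj_pair2 _ _ _ _ _ em; subst e.
have [p' pP] := H (arity1 s') erefl; exists p'; split; last exact/pP.
have ioi := @iotup_inj S (arity1 s').
refine (@sub_finite_set _ _ _ _ (@finite_preimage _ _ [set t | sat p t]
  (@iotup _ _ (Meq M) (Meq (reduct S M)) (@geq L M S) (@ioq L M S) (arity1 s')) _ fp)).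
  by move=> t /pP pt; exact: pt.
by move=> t u _ _; exact: ioi.
Qed.

End EqTransfer.

(** * Compactness in M^eq *)

Section RealTranslation.
Variables (L : signature) (M : structure L).

(** The arity of the real tuples that represent, through [cls], the elements of sort s; an element
    of a home sort is represented by itself. *)
Definition rar (s : srt (eq_signature M)) : arity (srt L) :=
  match s with inl s => arity1 s | inr th => eqrel_arity th end.

Definition cls (s : srt (eq_signature M)) : tuple_in M (rar s) -> Meq M s :=
  match s return tuple_in M (rar s) -> Meq M s with
  | inl s => fun t => t (exist _ 0 isT : idx 1)
  | inr th => fun t => exist _ (eq_class t) (ex_intro _ t erefl)
  end.

Lemma cls_surj s (m : Meq M s) : exists t, cls t = m.
Proof.
case: s m => [s|th] m; first by exists (fun=> m).
by case: m => C [t Ct]; exists t; apply: sval_inj.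
Qed.

Lemma cls_eq (th : eqrel M) (t u : tuple_in M (eqrel_arity th)) :
  @cls (inr th) t = @cls (inr th) u <-> sat2 (eqrel_form th) t u.
Proof.
split=> [[e]|tu].
  have : eq_class u u by exact: eqrel_refl.
  by rewrite -[X in X _]e.
apply: sval_inj => /=; apply: functional_extensionality_dep => w; apply: propext.
by split=> [tw|uw]; [exact: eqrel_trans (eqrel_sym tu) tw|exact: eqrel_trans tu uw].
Qed.

(* Each variable v : V s is represented by the tuple rep s v of real variables.
   The family of all pairs of an imaginary variable and a coordinate would live
   in too large a universe for formulas, so V0 and rep are left arbitrary. *)
Definition renv (V : srt (eq_signature M) -> Type) (V0 : srt L -> Type)
    (rep : forall s, V s -> tuple_in V0 (rar s)) (e0 : env V0 M) : env V (Meq M) :=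
  fun s v => cls (fun i => e0 _ (rep s v i)).

Lemma real_term (V : srt (eq_signature M) -> Type) (V0 : srt L -> Type)
    (rep : forall s, V s -> tuple_in V0 (rar s)) s (t : term V s) :
  exists ts : (forall i, @term L V0 (asort (rar s) i)), forall e0 : env V0 M,
    cls (fun i => teval e0 (ts i)) = teval (renv rep e0) t.
Proof.
elim: t => {s} [s v|[f|th] ts /dchoice[tts tsP]].
- by exists (fun i => Var (rep s v i)).
- exists (fun=> @App L V0 f (fun i => tts i (exist _ 0 isT))) => e0 /=.
  rewrite (_ : (fun i => teval (renv rep e0) (ts i)) =
    (fun i => teval e0 (tts i (exist _ 0 isT)))) //.
  by apply: functional_extensionality_dep => i; rewrite -tsP.
- exists (fun i => tts i (exist _ 0 isT)) => e0 /=; apply: sval_inj => /=.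
  rewrite (_ : (fun i => teval (renv rep e0) (ts i)) =
    (fun i => teval e0 (tts i (exist _ 0 isT)))) //.
  by apply: functional_extensionality_dep => i; rewrite -tsP.
Qed.

(** An equation in the sort of th turns into the formula of th between representatives, and a
    quantifier over the sort into one over tuples, since [cls] is surjective. *)
Lemma real_dfn (V : srt (eq_signature M) -> Type) (p : formula V) :
  forall (V0 : srt L -> Type) (rep : forall s, V s -> tuple_in V0 (rar s)),
  dfn (fun e0 : env V0 M => holds p (renv rep e0)).
Proof.
elim: p => {V} [V|V s t u|V r ts|V p IHp q IHq|V s p IH] V0 rep.
- exact: dfn_bot.
- have [tt ttP] := real_term rep t; have [uu uuP] := real_term rep u.
  apply: (@dfn_iff _ _ _ (fun e0 => cls (fun i => teval e0 (tt i)) =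
    cls (fun i => teval e0 (uu i)))); first by move=> e0; rewrite ttP uuP.
  case: s tt uu {ttP uuP t u} => [s|th] tt uu.
    exact: (dfn_eq M (tt (exist _ 0 isT)) (uu (exist _ 0 isT))).
  pose sg s (v : vsum (tvar (eqrel_arity th)) (tvar (eqrel_arity th)) s) : term V0 s :=
    match v with
    | inl x => match x with TVar i => tt i end
    | inr x => match x with TVar i => uu i end
    end.
  apply: dfn_iff (dfn_tsub sg (dfn_holds M (eqrel_form th))) => e0.
  rewrite cls_eq /sat2; set e1 := (X in holds _ X <-> _); set e2 := (X in _ <-> holds _ X).
  by rewrite (_ : e1 = e2) //; apply: env_ext => s [[i]|[i]].
- have /dchoice[tts tsP] := fun i => real_term rep (ts i).
  apply: dfn_iff (dfn_holds M (@FRel L V0 r (fun i => tts i (exist _ 0 isT)))) => e0 /=.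
  rewrite (_ : (fun i => teval (renv rep e0) (ts i)) =
    (fun i => teval e0 (tts i (exist _ 0 isT)))) //.
  by apply: functional_extensionality_dep => i; rewrite -tsP.
- exact: dfn_imp.
- pose rep' s' (v : vsum V (tvar (arity1 s)) s') :
      tuple_in (vsum V0 (tvar (rar s))) (rar s') :=
    match v with
    | inl v => fun i => inl (rep _ v i)
    | inr x => match x with TVar j => fun i => inr (@TVar _ (rar s) i) end
    end.
  apply: dfn_iff (dfn_forall_tuple (IH _ rep')) => e0 /=.
  have E (t : tuple_in M (rar s)) : renv rep' (esum e0 (tenv t)) =
      esum (renv rep e0) (@tenv _ (Meq M) (arity1 s) (fun=> cls t)).
    by apply: env_ext => s' [v|[j]].
  split=> H m; last by rewrite E; exact: H.
  by have [t <-] := cls_surj m; rewrite -E.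
Qed.

End RealTranslation.

Definition listed (T : Type) : Prop := exists l : seq T, forall x, List.In x l.

Lemma listed_idx n : listed (idx n).
Proof. by exists (idxs n); exact: In_idxs. Qed.

Lemma listed_ord n : listed 'I_n.
Proof. by exists (enum 'I_n) => i; apply: In_mem; rewrite mem_enum. Qed.

Lemma listed_sigma (I : Type) (J : I -> Type) :
  listed I -> (forall i, listed (J i)) -> listed {i : I & J i}.
Proof.
move=> [l lP] /dchoice[m mP].
exists (flatten [seq [seq existT J i j | j <- m i] | i <- l]) => -[i j].
exact: In_flatten_map (lP i) (List.in_map _ _ _ (mP i j)).
Qed.

Lemma listed_sum (T U : Type) : listed T -> listed U -> listed (T + U).
Proof.
move=> [l lP] [m mP]; exists ([seq inl x | x <- l] ++ [seq inr y | y <- m]).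
by move=> [x|y]; apply/List.in_app_iff; [left|right]; exact: List.in_map.
Qed.

Lemma In_nth (T : Type) (x0 x : T) s : List.In x s -> exists2 i, i < size s & nth x0 s i = x.
Proof.
elim: s => //= y s IH [->|/IH[i is_ <-]]; first by exists 0.
by exists i.+1.
Qed.

(** Saturation speaks of one tuple of variables, so a finite family of variables is packed into one.
    The listing may repeat elements; g picks a position for each. *)
Lemma flatten_arity (L : signature) (M : structure L) (T : Type) (so : T -> srt L) :
  listed T -> exists (D : arity (srt L)) (v : forall x, tvar D (so x)),
    forall m : (forall x, M (so x)), exists r : tuple_in M D, forall x, tenv r (v x) = m x.
Proof.
move=> [l lP].
have [n [f fsurj]] : exists n (f : idx n -> T), forall x, exists j, f j = x.
  case: l lP => [|x0 l] lP.
    by exists 0, (fun j => match notF (svalP j) with end) => x; case: (lP x).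
  exists (size (x0 :: l)), (fun j => nth x0 (x0 :: l) (sval j)) => x.
  by have [i il <-] := In_nth x0 (lP x); exists (exist _ i il).
have [g gP] := choice fsurj.
pose D := Arity (fun j : idx n => so (f j)).
exists D, (fun x => eq_rect _ (fun y => tvar D (so y)) (@TVar _ D (g x)) _ (gP x)) => m.
have E j y (e : f j = y) : @tenv _ M D (fun j => m (f j)) _
    (eq_rect _ (fun y => tvar D (so y)) (@TVar _ D j) _ e) = m y.
  by case: _ / e.
by exists (fun j => m (f j)) => x; exact: E.
Qed.

Section Compactness.
Variables (K : Type) (hK : card_lt nat K) (L : signature) (M : structure L).
Hypothesis satM : saturated K M.

Lemma pdfn_of_dfn (P : pset M) a (X : set (tuple_in M a))
    (Y : env (vsum (tvar a) (params P)) M -> Prop) :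
  dfn Y -> (forall t, X t <-> Y (esum (tenv t) (@penv L M P))) -> pdfn P X.
Proof. by move=> [p pP] XY; exists p => t; rewrite XY pP. Qed.

Section Representatives.
Variable rp : forall s, Meq M s -> tuple_in M (rar s).
Hypothesis rpP : forall s (m : Meq M s), cls (rp m) = m.
Variable P : pset (Meq M).

(** The real parameters that replace the imaginary ones of P: the coordinates of the chosen
    representatives. *)
Definition representatives : pset M := fun s m =>
  exists s' (e : Meq M s') i, P e /\ existT M s m = existT M _ (rp e i).

Lemma representativesP s (e : Meq M s) i : P e -> representatives (rp e i).
Proof. by move=> Pe; exists s, e, i. Qed.

Lemma small_representatives : small K P -> small K representatives.
Proof.
move=> smallP; apply: card_lt_embeds (card_lt_prod hK smallP hK).
apply: (@embeds_of_rel _ _ (fun (c : {s : srt L & params representatives s}) y =>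
  exists i, sval i = y.2 /\
    existT M _ (sval (projT2 c)) = existT M _ (rp (sval (projT2 y.1)) i))).
- move=> [s [m [s' [e [i [Pe em]]]]]].
  by exists (existT _ s' (exist _ e Pe), sval i), i.
- move=> c c' [y n] [/= i [<- e]] [j [ij e']].
  have {}ij : i = j by apply: sval_inj; rewrite ij.
  by subst j; apply: params_inj; rewrite e e'.
Qed.

End Representatives.

(** If every formula of tp(b / P) had k distinct solutions whose instances of p are jointly
    satisfied, saturation would give k distinct realizations of the whole type with that
    property. *)
Lemma compact_inconsistency (P : pset (Meq M)) (a d : arity (srt (eq_signature M)))
    (p : formula2 a d) (b : tuple_in (Meq M) d) k : small K P ->
  (forall f : 'I_k -> tuple_in (Meq M) d, injective f -> (forall j, same_type P b (f j)) ->
     ~ exists t, forall j, sat2 p t (f j)) ->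
  exists th : pformula P d, sat th b /\
    forall f : 'I_k -> tuple_in (Meq M) d, injective f -> (forall j, sat th (f j)) ->
      ~ exists t, forall j, sat2 p t (f j).
Proof.
move=> smallP incons; apply: contrapT => nth.
have H (th : pformula P d) : sat th b -> exists f : 'I_k -> tuple_in (Meq M) d,
    [/\ injective f, forall j, sat th (f j) & exists t, forall j, sat2 p t (f j)].
  move=> thb; apply: contrapT => nf; apply: nth; exists th; split=> // f fi ft [t tP].
  by apply: nf; exists f; split=> //; exists t.
have [rp rpP] : exists rp : (forall s, Meq M s -> tuple_in M (rar s)),
    forall s (m : Meq M s), cls (rp s m) = m.
  have rps s := choice (@cls_surj L M s).
  by exists (fun s => projT1 (rps s)) => s; exact: projT2 (rps s).
(* The real coordinates of representatives of k tuples of arity d and one tuple of arity a. *)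
pose T : Type := (({j : 'I_k & {i : idx (alen d) & idx (alen (rar (asort d i)))}}) +
  {i : idx (alen a) & idx (alen (rar (asort a i)))})%type.
pose so (x : T) : srt L := match x with
  | inl y => asort (rar (asort d (projT1 (projT2 y)))) (projT2 (projT2 y))
  | inr y => asort (rar (asort a (projT1 y))) (projT2 y) end.
have listedT : listed T.
  apply: listed_sum; last by apply: listed_sigma => [|i]; exact: listed_idx.
  apply: listed_sigma => [|j]; first exact: listed_ord.
  by apply: listed_sigma => [|i]; exact: listed_idx.
have [D [v vP]] := flatten_arity M so listedT.
pose vd j i l : tvar D (asort (rar (asort d i)) l) := v (inl (existT _ j (existT _ i l))).
pose va i l : tvar D (asort (rar (asort a i)) l) := v (inr (existT _ i l)).
pose Pr := representatives rp P.
pose V0 := vsum (tvar D) (params Pr).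
have smallPr : small K Pr by exact: small_representatives.
pose repd j s (x : tvar d s) : tuple_in V0 (rar s) :=
  match x with TVar i => fun l => inl (vd j i l) end.
pose repa s (x : tvar a s) : tuple_in V0 (rar s) :=
  match x with TVar i => fun l => inl (va i l) end.
pose fd j (r : tuple_in M D) : tuple_in (Meq M) d :=
  fun i => cls (fun l => tenv r (vd j i l)).
pose td (r : tuple_in M D) : tuple_in (Meq M) a := fun i => cls (fun l => tenv r (va i l)).
pose F : set (set (tuple_in M D)) := [set Y |
  [\/ exists j (th : pformula P d), sat th b /\ Y = [set r | sat th (fd j r)],
      exists j j', j <> j' /\ Y = [set r | fd j r <> fd j' r] |
      exists j, Y = [set r | sat2 p (td r) (fd j r)]]].
have Fd Y : F Y -> pdfn Pr Y.
  case=> [[j [th [_ ->]]]|[j [j' [_ ->]]]|[j ->]].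
  - pose rep s (x : vsum (tvar d) (params P) s) : tuple_in V0 (rar s) := match x with
      | inl x => repd j s x
      | inr c => fun l => inr (exist _ (rp s (sval c) l)
          (@representativesP rp P s (sval c) l (svalP c)))
      end.
    apply: (pdfn_of_dfn (real_dfn th rep)) => r.
    rewrite /= /sat; set e1 := (X in holds _ X <-> _); set e2 := (X in _ <-> holds _ X).
    rewrite (_ : e1 = e2) //; apply: env_ext => s [[i]|c] //.
    by rewrite /e2 /renv /= rpP.
  - pose rep s (x : vsum (tvar d) (tvar d) s) : tuple_in V0 (rar s) := match x with
      | inl x => repd j s x | inr x => repd j' s x end.
    pose q i : formula2 d d := FEq (Var (inl (TVar i))) (Var (inr (TVar i))).
    apply: (pdfn_of_dfn (dfn_not (dfn_forall_idx (fun i => real_dfn (q i) rep)))) => r.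
    rewrite /=; split=> n e; apply: n; last first.
      by move=> i; exact: (congr1 (fun f => f i) e).
    exact: functional_extensionality_dep.
  - pose rep s (x : vsum (tvar a) (tvar d) s) : tuple_in V0 (rar s) := match x with
      | inl x => repa s x | inr x => repd j s x end.
    apply: (pdfn_of_dfn (real_dfn p rep)) => r.
    rewrite /= /sat2; set e1 := (X in holds _ X <-> _); set e2 := (X in _ <-> holds _ X).
    by rewrite (_ : e1 = e2) //; apply: env_ext => s [[i]|[i]].
have [l lF|r rF] := saturated_fip satM smallPr Fd.
  (* The finitely many formulas of the type that occur in l are conjoined into th; distinctness and
     the instances of p are kept as hypotheses on r. *)
  have [th [thb thP]] : exists th : pformula P d, sat th b /\ forall r,
      (forall j, sat th (fd j r)) -> injective (fd^~ r) ->
      (forall j, sat2 p (td r) (fd j r)) -> forall Y, List.In Y l -> Y r.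
    elim: l lF => [|Y l IH] lF.
      by exists (FImp (FBot _) (FBot _)); split=> //; rewrite /sat /=.
    have [th [thb thP]] := IH (fun Z Zl => lF Z (or_intror Zl)).
    case: (lF Y (or_introl erefl)) => [[j [th' [thb' ->]]]|[j [j' [jj ->]]]|[j ->]].
    + have [q qP] := dfn_and (dfn_holds (Meq M) th) (dfn_holds (Meq M) th').
      exists q; split=> [|r rq ri rp_ Z [<-|]]; first exact/qP.
        by have /qP[] := rq j.
      by apply: thP => // j'; have /qP[] := rq j'.
    + exists th; split=> // r rq ri rp_ Z [<-|]; last exact: thP.
      by move=> /ri.
    + exists th; split=> // r rq ri rp_ Z [<-|]; last exact: thP.
      exact: rp_.
  have [f [fi fth [t tP]]] := H th thb.
  pose m (x : T) : M (so x) := match x return M (so x) with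
    | inl (existT j (existT i l)) => rp _ (f j i) l
    | inr (existT i l) => rp _ (t i) l end.
  have [r rm] := vP m.
  have fdE j : fd j r = f j.
    apply: functional_extensionality_dep => i; rewrite /fd -[RHS]rpP; congr cls.
    apply: functional_extensionality_dep => i'.
    exact: (rm (inl (existT _ j (existT _ i i')))).
  have tdE : td r = t.
    apply: functional_extensionality_dep => i; rewrite /td -[RHS]rpP; congr cls.
    apply: functional_extensionality_dep => i'.
    exact: (rm (inr (existT _ i i'))).
  exists r; apply: thP => [j|j j'|j]; rewrite !fdE ?tdE //.
  exact: fi.
apply: (incons (fun j => fd j r)).
- move=> j j' e; apply: contrapT => jj.
  by apply: (rF [set r | fd j r <> fd j' r]) e; apply: Or32; exists j, j'.
- have satf (th : pformula P d) j : sat th b -> sat th (fd j r).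
    by move=> thb; apply: (rF [set r | sat th (fd j r)]); apply: Or31; exists j, th.
  (* The converse follows by applying [satf] to the negation of th. *)
  move=> j th; split; first exact: satf.
  move=> thf; apply: contrapT => nthb.
  exact: (satf (FImp th (FBot _)) j nthb thf).
- exists (td r) => j.
  by apply: (rF [set r | sat2 p (td r) (fd j r)]); apply: Or33; exists j.
Qed.

End Compactness.

(** * One-basedness *)

Section OneBased.
Variables (K : Type) (L : signature) (M : structure L).
Hypotheses (hK : card_lt nat K) (hsrt : card_lt (srt L) K).
Hypotheses (hsym : card_lt (fsym L + rsym L) K) (satM : saturated K M).

Notation io S := (@iotup _ _ (Meq M) (Meq (reduct S M)) (@geq L M S) (@ioq L M S) _).
Notation cast E t := (eq_rect _ (tuple_in (Meq M)) t _ E).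

Lemma small_home (Q : pset M) : small K Q -> small K (home Q).
Proof.
apply: card_lt_embeds.
apply: (@embeds_of_rel _ _ (fun (c : {s & params (home Q) s}) (d : {s & params Q s}) =>
  existT (Meq M) _ (sval (projT2 c)) = existT (Meq M) (inl (projT1 d)) (sval (projT2 d)))).
  move=> [[s|th] [m Qm]] //=.
  by exists (existT _ s (exist _ m Qm)).
by move=> c c' d e e'; apply: (@params_inj _ (Meq M)); rewrite e e'.
Qed.

Lemma small_acleq (Q : pset M) : small K Q -> small K (acleq Q).
Proof.
move=> smallQ; apply: (small_acl hK).
- exact: card_lt_eq_srt.
- exact: card_lt_eq_sym.
- exact: small_home.
Qed.

Lemma coords_ioq S d' (c : tuple_in (Meq (reduct S M)) d') s (m : Meq (reduct S M) s) :
  coords [set io S c] (ioq m) <-> coords [set c] m.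
Proof.
split; last by case=> t i ->; exact: (@Coords _ _ _ [set io S c] (io S c) i).
have gen s0 (x : Meq M s0) : coords [set io S c] x -> forall s (m : Meq (reduct S M) s),
    existT (Meq M) s0 x = existT (Meq M) (geq s) (ioq m) -> coords [set c] m.
  case=> t i ->  {}s {}m e.
  have es : asort d' i = s := @geq_inj L M S _ _ (congr1 (@projT1 _ _) e).
  subst s; have /ioq_inj <- := inj_pair2 _ _ _ _ _ e.
  exact: Coords.
by move=> /gen; apply.
Qed.

Section Base.
Variables Q1 Q2 : pset M.
Hypotheses smallQ1 : small K Q1.
Let E : pset (Meq M) := isub (acleq Q1) (acleq Q2).
Let E_ S : pset (Meq (reduct S M)) :=
  isub (@acleq (sig_of S) (reduct S M) Q1) (@acleq (sig_of S) (reduct S M) Q2).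

Lemma base_ioq S s (m : Meq (reduct S M) s) : E_ m -> E (ioq m).
Proof. by move=> [m1 m2]; split; exact: acleq_ioq. Qed.

Lemma ev_base s (e : Meq M s) : E e -> eventually (fun S => forall s' m,
  existT (Meq M) s e = existT (Meq M) (geq s') (ioq m) -> @E_ S s' m).
Proof.
move=> [e1 e2]; have := ev_and (ev_acleq e1) (ev_acleq e2).
by apply: ev_imp => S [H1 H2] s' m em; split; [exact: H1|exact: H2].
Qed.

(** The transports p' and b' are universally quantified because they are fixed only after the
    subsignature has been chosen. *)
Lemma ev_divides (nu : notion) (a d : arity (srt (eq_signature M))) (p : formula2 a d)
    (b : tuple_in (Meq M) d) : divides_in nu E p b ->
  eventually (fun S => forall a' d' (Ea : amap (@geq L M S) a' = a)
      (Ed : amap (@geq L M S) d' = d) (p' : formula2 a' d') b',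
    (forall t u, sat2 p (cast Ea (io S t)) (cast Ed (io S u)) <-> sat2 p' t u) ->
    cast Ed (io S b') = b -> divides_in nu (@E_ S) p' b').
Proof.
case: nu => /=.
  move=> [k [bs [bst incons]]]; apply: ev_all => S a' d' Ea Ed p' b' pp' bb'.
  subst a d b; rewrite /= in pp' bst incons.
  have /dchoice[bs' bsP] := fun n => iotup_surj (bs n).
  exists k, bs'; split=> [n|f fi [t tP]].
    apply: (@same_type_reduct _ _ S (@E_ S) E); first exact: base_ioq.
    by rewrite bsP; exact: bst.
  apply: (incons f fi); exists (io S t) => j.
  have {}tP := tP j.
  by rewrite -bsP; apply/pp'.
move=> [e [c [inf [k incons]]]].
have smallP : small K (usub E (coords [set c])).
  apply: (@small_usub K hK _ (Meq M)); last exact: small_coords1.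
  by apply: small_sub (small_acleq smallQ1) => s m [].
have [th [thb thP]] := compact_inconsistency hK satM smallP incons.
(* The base in the reduct, described through [ioq] because the preimage c' of c exists only once S
   is known. *)
pose P' S : pset (Meq (reduct S M)) := fun s m => @E_ S s m \/ coords [set c] (ioq m).
have hP s (x : Meq M s) : usub E (coords [set c]) x -> eventually (fun S => forall s' m,
    existT (Meq M) s x = existT (Meq M) (geq s') (ioq m) -> @P' S s' m).
  case=> [Ex|cx].
    by have := ev_base Ex; apply: ev_imp => S H s' m xm; left; exact: H.
  apply: ev_all => S s' m xm; right.
  have es : s = geq s' := congr1 (@projT1 _ _) xm.
  by subst s; have <- := inj_pair2 _ _ _ _ _ xm.
have := ev_and (ev_arity e) (ev_pformula (P' := P') th hP).
apply: ev_imp => S [[e' Ee] H] a' d' Ea Ed p' b' pp' bb'.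
have [th' thP'] := H d' Ed.
subst a d e b; rewrite /= in pp' thP' thP inf thb.
have [c' cc'] := iotup_surj c.
exists e', c'.
have -> : usub (@E_ S) (coords [set c']) = P' S.
  apply: functional_extensionality_dep => s; apply: functional_extensionality_dep => m.
  apply: propext; rewrite /P' /usub -cc'.
  by split=> -[|/coords_ioq]; [left|right|left|right].
have PP s (m : Meq (reduct S M) s) : @P' S s m -> usub E (coords [set c]) (ioq m).
  by case=> [/base_ioq|]; [left|right].
split.
  (* Realizations of the L-type come from realizations of the reduct type, so infinity is
     inherited. *)
  move=> fin; apply: inf; apply: (sub_finite_set _ (finite_image (io S) fin)) => t.
  have [t' <-] := iotup_surj t => tt'.
  by exists t' => //; exact: same_type_reduct PP tt'.
exists k => f fi ft [t tP].
apply: (thP (fun j => io S (f j))).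
- by move=> j j' /iotup_inj /fi.
(* The formula th' belongs to the reduct type of b', so every realization of that type satisfies it,
   and hence th. *)
- by move=> j; apply/thP'/(ft j th'); apply/thP'.
- by exists (io S t) => j; apply/pp'.
Qed.

End Base.

Variables (W : Type) (Lw : W -> subsignature L) (hW : sufficient Lw).
Variables (A : pset M) (smallA : small K A).
Variables (a : arity (srt L)) (pi : set (pformula A a)).

Lemma one_based_of_reducts (nu : notion) :
  (forall w, one_based (reduct_type (Lw w) pi) K nu) -> one_based pi K nu.
Proof.
move=> hw B C Bpi Cpi smallB smallC a0 b bB d p c cE pbc [n [ds [ps [cs [hdiv himp]]]]].
set Q1 := usub A (coords B) in cE hdiv; set Q2 := usub A (coords C) in cE hdiv.
have smallQ1 : small K Q1 by exact: small_usub.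
pose E_ S : pset (Meq (reduct S M)) :=
  isub (@acleq (sig_of S) (reduct S M) Q1) (@acleq (sig_of S) (reduct S M) Q2).
pose H_ S : pset (Meq (reduct S M)) := @home (sig_of S) (reduct S M) (coords C).
(* Each coordinate of c is either in C, and so in every base, or in acl^eq, and so in the base of
   all large reducts. *)
have evc : eventually (fun S => forall j s' m,
    existT (Meq M) _ (c j) = existT (Meq M) (geq s') (ioq m) ->
    @usub _ _ (@H_ S) (@E_ S) s' m).
  apply: ev_idx => j; case: (cE j) => [|Ej]; last first.
    by have := ev_base Ej; apply: ev_imp => S H s' m em; right; exact: H.
  move: (c j); case: (asort d j) => // s x Cx; apply: ev_all => S [s'|th] m //= em.
  have [es] := congr1 (@projT1 _ _) em; subst s'.
  by left; have <- := inj_pair2 _ _ _ _ _ em.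
(* The only choice of w: it carries the arities, the forking formula with its cover, the dividing of
   each piece, and the parameters c. *)
have [w [[[eva evd] evds] [[evp evps] [evdiv {}evc]]]] := sufficient_ev hW
  (ev_and (ev_and (ev_and (ev_arity a0) (ev_arity d)) (ev_fin (fun i => ev_arity (ds i))))
   (ev_and (ev_and (ev_formula2 p) (ev_fin (fun i => ev_formula2 (ps i))))
     (ev_and (ev_fin (fun i => ev_divides smallQ1 (hdiv i))) evc))).
set S := Lw w in eva evd evds evp evps evdiv evc.
have [a' Ea] := eva; have [d' Ed] := evd; have [ds' Eds] := dchoice evds.
have [p' pp'] := evp a' d' Ea Ed.
have /dchoice[ps' psP] := fun i => evps i a' (ds' i) Ea (Eds i).
subst a0 d; rewrite /= in pp' psP.
have [b' bb'] := iotup_surj b; have [c' cc'] := iotup_surj c.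
(* The arities [ds i] form a family and are not eliminated by substitution, unlike those of b and c,
   so casts remain here. *)
have cast_surj i : exists cs' : tuple_in (Meq (reduct S M)) (ds' i),
    cast (Eds i) (io S cs') = cs i.
  by move: (cs i); case: _ / (Eds i) => t; exact: iotup_surj.
have /dchoice[cs' csP] := cast_surj.
subst b c.
have := hw w B C; rewrite -/S !coords_reduct => /(_ _ _ smallB smallC) ind.
apply: (ind _ _ a' b' _ d' p' c').
- by move=> t /Bpi; exact: realizations_reduct.
- by move=> t /Cpi; exact: realizations_reduct.
- by move=> i; have := bB i; rewrite /iotup /=; case: (asort a' i) (b' i).
- by move=> i; exact: (evc i _ (c' i) erefl).
- exact/pp'.
(* The same cover shows that p' forks in the reduct, against one-basedness there: every t in the
   reduct is a tuple of M^eq. *)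
exists n, ds', ps', cs'; split=> [i|t pt].
  exact: (evdiv i a' (ds' i) erefl (Eds i) _ _ (psP i) (csP i)).
have [i hi] := himp (io S t) ((pp' _ _).2 pt).
by exists i; apply/psP; rewrite csP.
Qed.

End OneBased.

Theorem theorem4 (L : signature) (T : set (formula (@novar (srt L))))
    (W : Type) (Lw : W -> subsignature L) (hW : sufficient Lw)
    (K : Type) (M : structure L) (hM : models M T)
    (A : pset M) (hsat : sufficiently_saturated K A)
    (a : arity (srt L)) (pi : set (pformula A a)) (hpi : partial_type pi) :
  [/\ (forall w, trivial (reduct_type (Lw w) pi)) -> trivial pi,
      (forall nu : notion,
         (forall w, one_based (reduct_type (Lw w) pi) K nu) ->
         one_based pi K nu)
    & (forall R : tuple_in M a -> tuple_in M a -> tuple_in M a -> Prop,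
         definable3 M a R ->
         (forall w, definable3 (reduct (Lw w) M) a R ->
            modular_group (reduct_type (Lw w) pi) R) ->
         modular_group pi R)].
Proof.
case: hsat => hK [hsrt hsym] smallA satM; split.
- exact: trivial_of_reducts.
- by move=> nu; apply: (one_based_of_reducts hK hsrt hsym satM hW smallA).
- by move=> R; apply: (modular_group_of_reducts hK hW satM smallA).
Qed.
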